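(* Let $n\ge 3$ and let $G=\mathrm{Hol}(C_{2^n})$, with the presentation $$G=\langle a,b,c\mid a^{2^n}=b^{2^{n-2}}=c^2=1,\ b^{-1}ab=a^5,\ c^{-1}ac=a^{-1},\ c^{-1}bc=b\rangle.$$ With $\mathcal{O}_k$, $\widetilde\rho_{0,\omega,\pm1}$, $\widetilde\rho_{1,\omega,\pm1}$ and $\widetilde\rho_{k,\omega}$ ($2\le k\le n$) as defined in the context, the following hold. 1. $G$ has exactly $2\phi(2^n)=2^n$ complex representations of degree $1$, and they are $\widetilde\rho_{0,\omega,\pm1}$ and $\widetilde\rho_{1,\omega,\pm1}$, where $\omega$ varies over the set of $2^{n-2}$-th roots of unity. 2. For each $k=2,\dots,n$, corresponding to the orbit $\mathcal{O}_k$, $G$ has exactly $2^{n-k}$ irreducible complex representations, of degree $\phi(2^k)$, and they are $\widetilde\rho_{k,\omega}$, where $\omega$ varies over the set of $2^{n-k}$-th roots of unity. 3. $G$ has exactly $(1+2+\cdots+2^n)-2^{n-1}$ inequivalent irreducible complex representations. 4. Corresponding to the orbit $\mathcal{O}_n$ there is only one irreducible complex representation, which has degree $\phi(2^n)$; it is the unique faithful irreducible complex representation of $G$.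
   Context: $C_m$ is the cyclic group of order $m$; $\mathrm{Hol}(C_m)=C_m\rtimes\mathrm{Aut}(C_m)$ for the natural action; $\phi$ is Euler's function. Representations are counted up to equivalence. Let $N=\langle a\rangle$, let $\zeta$ be a primitive $2^n$-th root of unity, and let $\widehat N=\{\widetilde\chi_i:0\le i\le 2^n-1\}$ be the set of irreducible complex representations of $N$, where $\widetilde\chi_i(a)=\zeta^i$. $G$ acts on $\widehat N$ by $\chi^g(x)=\chi(g^{-1}xg)$. $\mathcal{O}_0$ denotes the orbit of $\widetilde\chi_0$, and for $1\le k\le n$, $\mathcal{O}_k$ denotes the orbit of $\widetilde\chi_{2^{n-k}}$; these are all the orbits. The irreducible representations of $G$ corresponding to an orbit $\mathcal{O}$ are those obtained by the Wigner–Mackey method of little groups: choose $\chi\in\mathcal{O}$, let $I_\chi$ be its stabilizer in $G$ and $H_\chi=I_\chi\cap\langle b,c\rangle$, so $I_\chi=N\rtimes H_\chi$; extend $\chi$ to $I_\chi$ trivially on $H_\chi$; for each irreducible complex representation $\rho$ of $H_\chi$, regarded as a representation of $I_\chi$ via $I_\chi\to H_\chi$, take the representation of $G$ induced from $\chi\otimes\rho$. For a $2^{n-2}$-th root of unity $\omega$ and a sign $\epsilon\in\{1,-1\}$: $\widetilde\rho_{0,\omega,\epsilon}$ is the degree $1$ representation $a\mapsto1$, $b\mapsto\omega$, $c\mapsto\epsilon$, and $\widetilde\rho_{1,\omega,\epsilon}$ is the degree $1$ representation $a\mapsto-1$, $b\mapsto\omega$, $c\mapsto\epsilon$. For $2\le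 k\le n$ and a $2^{n-k}$-th root of unity $\omega$, put $s=2^{k-2}$; $\widetilde\rho_{k,\omega}$ is the representation of degree $2s=2^{k-1}$ on a space with basis $e_0,\dots,e_{s-1},f_0,\dots,f_{s-1}$ given by: $a$ acts by $e_j\mapsto\zeta^{5^j2^{n-k}}e_j$, $f_j\mapsto\zeta^{-5^j2^{n-k}}f_j$; $b$ acts by $e_j\mapsto e_{j+1}$, $f_j\mapsto f_{j+1}$ for $0\le j<s-1$ and $e_{s-1}\mapsto\omega e_0$, $f_{s-1}\mapsto\omega f_0$; $c$ acts by $e_j\mapsto f_j$, $f_j\mapsto e_j$. *)

(* Defs.v *)
From HB Require Import structures.
From mathcomp Require Import all_boot all_order all_fingroup all_algebra.
From mathcomp Require Import all_solvable all_field all_character.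

Set Implicit Arguments.
Unset Strict Implicit.
Unset Printing Implicit Defensive.

Import GRing.Theory.
Local Open Scope ring_scope.

Section Holomorph.

Local Open Scope group_scope.

Variables (gT : finGroupType) (C : {group gT}).

Definition Hol_type : finGroupType := sdprod_groupType [Aut C]%gact.

Definition Hol : {group Hol_type} := [set: Hol_type]%G.

End Holomorph.

Section HolomorphGenerators.

Local Open Scope group_scope.

(* For [C] cyclic of order 2^n, [Hol C] is generated by elements satisfying    *)
(* the relations of the presentation. Any such triple presents [Hol C], since *)
(* a group with these generators and relations has order at most              *)
(* 2^(2n-1) = #|Hol C|.                                                       *)
Lemma Hol_cyclic_generators n (gT : finGroupType) (C : {group gT}) :
    (2 < n)%N -> cyclic C -> #|C| = (2 ^ n)%N ->
  exists a b c : Hol_type C,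
    [/\ a ^+ (2 ^ n) = 1, b ^+ (2 ^ (n - 2)) = 1 & c ^+ 2 = 1] /\
    [/\ a ^ b = a ^+ 5, a ^ c = a^-1, b ^ c = b
      & Hol C :=: <<[set a; b; c]>>].
Proof.
move=> n_gt2 cycC oC.
have pC: 2.-group C by rewrite /pgroup oC pnatX pnat_id.
have ntC: C :!=: 1.
  by rewrite -cardG_gt1 oC -{1}(expn0 2) ltn_exp2l // ltnW // ltnW.
have := cyclic_pgroup_Aut_structure pC cycC ntC.
have on: logn 2 #|C| = n by rewrite oC pfactorK.
rewrite /= on.
have /negPf-> : n.-1 != 0%N by case: n n_gt2 {oC on} => [|[|]].
have /negPf-> : n.-1 != 1%N by case: n n_gt2 {oC on} => [|[|[|]]].
case=> m [[mE _ _ _ _] _ [t [tA ot mt [s [sA os ms /dprodP[_ defA cst _] _]]]]].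
have [x0 defC] := cyclicP cycC; have x0C: x0 \in C by rewrite defC cycle_id.
pose p1 := sdpair1_morphism [Aut C]%gact.
pose p2 := sdpair2_morphism [Aut C]%gact.
have os': #[s] = (2 ^ (n - 2))%N.
  by rewrite os -subn2.
exists (p1 x0), (p2 s), (p2 t).
have x0n: x0 ^+ (2 ^ n) = 1 by rewrite -oC expg_cardG.
have act1 u : u \in Aut C -> p1 x0 ^ p2 u = p1 (u x0).
  by move=> uA; rewrite -sdpair_act //=; congr (sdpair1 _ _); rewrite /= /actby /= x0C uA.
split; split.
- by rewrite -morphX //= x0n morph1.
- by rewrite -morphX //= -os' expg_order morph1.
- by rewrite -morphX //= -ot expg_order morph1.
- rewrite act1 // -mE // ms -morphX //; congr (p1 _).
  by rewrite expg_znat.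
- rewrite act1 // -mE // mt -morphV //; congr (p1 _).
  by rewrite expg_zneg // (expg_znat 1) // expg1.
- rewrite -morphJ //; congr (p2 _); apply/conjg_fixP/commgP.
  by apply: commute_sym; apply: (centsP cst); rewrite ?cycle_id.
apply/eqP; rewrite eqEsubset subsetT andbT -(im_sdpair [Aut C]%gact).
rewrite mul_subG //.
  apply/subsetP=> _ /morphimP[x Cx _ ->].
  have /cycleP[i ->]: x \in <[x0]> by rewrite -defC.
  by rewrite morphX // groupX // mem_gen // !inE eqxx.
apply/subsetP=> _ /morphimP[u Au _ ->].
have /mulsgP[_ _ /cycleP[i ->] /cycleP[j ->] ->]: u \in <[s]> * <[t]>.
  by rewrite defA.
rewrite morphM ?groupX // !morphX // groupM // groupX // mem_gen //.
  by rewrite !inE eqxx orbT.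
by rewrite !inE eqxx orbT.
Qed.

End HolomorphGenerators.

Section Representations.

Variables (F : fieldType) (gT : finGroupType).

(* [P] holds for exactly [N] representations of [G] up to equivalence. *)
Definition num_repr_classes (G : {group gT})
    (P : forall d, mx_representation F G d -> Prop) (N : nat) : Prop :=
  exists (d : 'I_N -> nat) (r : forall i, mx_representation F G (d i)),
    [/\ forall i, P _ (r i),
        forall i j, mx_rsim (r i) (r j) -> i = j
      & forall e (W : mx_representation F G e),
          P _ W -> exists i, mx_rsim W (r i)].

(* Up to equivalence, the representations satisfying [P] are the ones         *)
(* described by [rho x] for [x] satisfying [X], without repetition.           *)
Definition parametrized_by (G : {group gT})
    (P : forall d, mx_representation F G d -> Prop)
    (T : Type) (X : T -> Prop)
    (m : nat) (rho : T -> mx_representation F G m -> Prop) : Prop :=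
  [/\ forall x, X x -> exists V, rho x V,
      forall x V, X x -> rho x V -> P _ V,
      forall x y V W, X x -> X y -> rho x V -> rho y W -> mx_rsim V W -> x = y
    & forall d (W : mx_representation F G d), P _ W ->
        exists x V, [/\ X x, rho x V & mx_rsim W V]].

Section Induction.

Variables (G H : {group gT}) (m : nat).

Definition rcoset_rep (i : 'I_#|rcosets H G|) : gT := repr (enum_val i).

(* With [r_i] representatives of the right cosets of [H] in [G], the space of *)
(* the induced representation is the direct sum of the [r_i^-1 W], and the    *)
(* [(i, j)] block of [g] is the action of [r_i g r_j^-1] if it lies in [H],   *)
(* and [0] otherwise.                                                         *)
Definition ind_mx (W : mx_representation F H m) (g : gT) :
    'M[F]_(\sum_(i < #|rcosets H G|) m) :=
  \mxblock_(i < #|rcosets H G|, j < #|rcosets H G|)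
    (let h := (rcoset_rep i * g * (rcoset_rep j)^-1)%g in
     if h \in H then W h else 0).

Lemma rcoset_repP (i : 'I_#|rcosets H G|) :
  exists2 x, x \in G & enum_val i = (H :* x)%g /\ (H :* rcoset_rep i)%g = enum_val i.
Proof.
have /rcosetsP[x Gx defi] := enum_valP i; exists x => //; split=> //.
by rewrite /rcoset_rep defi rcoset_repr.
Qed.

Lemma ind_mx_repr (sHG : H \subset G) (W : mx_representation F H m) :
  mx_repr G (ind_mx W).
Proof.
have repG i : rcoset_rep i \in G.
  have [x Gx [defi Di]] := rcoset_repP i.
  have: rcoset_rep i \in (H :* rcoset_rep i)%g by rewrite rcoset_refl.
  by rewrite Di defi => /rcosetP[h Hh ->]; rewrite groupM // (subsetP sHG).
have repE i j : ((rcoset_rep i * (rcoset_rep j)^-1)%g \in H) = (i == j).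
  have [_ _ [_ Di]] := rcoset_repP i; have [_ _ [_ Dj]] := rcoset_repP j.
  rewrite -mem_rcoset; apply/idP/eqP => [|->]; last by rewrite rcoset_refl.
  by move/rcoset_eqP; rewrite Di Dj => /enum_val_inj.
split=> [|x y Gx Gy].
  rewrite -mxdiagZ /ind_mx /mxdiag; apply: eq_mxblock => i j /=.
  rewrite mulg1 repE; case: eqVneq => // ->.
  by rewrite mulgV repr_mx1 conform_mx_id.
rewrite /ind_mx mul_mxblock; apply: eq_mxblock => i j /=.
have [k Dk] : exists k : 'I_#|rcosets H G|, (rcoset_rep i * x * (rcoset_rep k)^-1)%g \in H.
  have Rz: (H :* (rcoset_rep i * x))%g \in rcosets H G.
    by rewrite mem_rcosets mulSGid // groupM.
  exists (enum_rank_in Rz (H :* (rcoset_rep i * x))%g).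
  have [_ _ [_ Dk]] := rcoset_repP (enum_rank_in Rz (H :* (rcoset_rep i * x))%g).
  rewrite enum_rankK_in // in Dk.
  by rewrite -mem_rcoset Dk rcoset_refl.
rewrite (bigD1 k) //= Dk big1 ?addr0 => [|l l'k]; last first.
  case: ifP => [Dl|_]; last by rewrite mul0mx.
  case/eqP: l'k; apply/eqP; rewrite -repE.
  by have := groupM (groupVr Dl) Dk; rewrite !invMg !invgK !mulgA mulgKV mulgKV.
have ->: (rcoset_rep i * (x * y) * (rcoset_rep j)^-1 =
          rcoset_rep i * x * (rcoset_rep k)^-1
           * (rcoset_rep k * y * (rcoset_rep j)^-1))%g.
  by rewrite !mulgA mulgKV.
by rewrite groupMl //; case: ifP => [Hh|_]; rewrite ?mulmx0 // repr_mxM.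
Qed.

Definition ind_repr (sHG : H \subset G) (W : mx_representation F H m) :
    mx_representation F G (\sum_(i < #|rcosets H G|) m) :=
  MxRepresentation (ind_mx_repr sHG W).

End Induction.

Section LittleGroups.

Variables (G N : {group gT}).

(* [chi] lies in the [G]-orbit of [chi0], where [chi0^g x = chi0 (g^-1 x g)]. *)
Definition in_char_orbit (chi0 chi : mx_representation F N 1) : Prop :=
  exists2 g, g \in G & {in N, forall x, chi x = chi0 (x ^ g)%g}.

Variable chi : mx_representation F N 1.

(* The restriction to ['N(N)] is immaterial for [N <| G]; it makes this a     *)
(* group in general, as for [inertia] in [mathcomp.character].                *)
Definition stabilizer : {set gT} :=
  [set g in 'N_G(N)%g | [forall x in N, chi (x ^ g)%g == chi x]].

Lemma stabilizer_group_set : group_set stabilizer.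
Proof.
apply/group_setP; split=> [|g h].
  by rewrite inE group1; apply/forall_inP=> x _; rewrite conjg1.
move=> /setIdP[NGg /forall_inP cg] /setIdP[NGh /forall_inP ch].
apply/setIdP; split; first by rewrite groupM.
apply/forall_inP=> x Nx; have /setIP[_ Ng] := NGg.
by rewrite conjgM (eqP (ch _ _)) ?memJ_norm // cg.
Qed.

Canonical stabilizer_group := Group stabilizer_group_set.

Lemma stabilizer_sub : stabilizer \subset G.
Proof. by apply/subsetP=> g /setIdP[/setIP[]]. Qed.

(* [V] is one of the representations of [G = N ><| K] obtained from [chi] by  *)
(* the method of little groups: [chi'] is the extension of [chi] to the       *)
(* stabilizer that is trivial on [H_chi], and [rho'] is the inflation of the  *)
(* irreducible representation [rho] of [H_chi].                               *)
Definition little_group_repr (K : {group gT}) d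
    (V : mx_representation F G d) : Prop :=
  let I := stabilizer_group in
  let H := (I :&: K)%G in
  exists (chi' : mx_representation F I 1)
         (m : nat) (rho : mx_representation F H m)
         (rho' : mx_representation F I m),
    [/\ {in N, forall x, chi' x = chi x} /\ {in H, forall x, chi' x = 1%:M},
        mx_irreducible rho,
        {in N, forall x, rho' x = 1%:M} /\ {in H, forall x, rho' x = rho x}
      & mx_rsim V (ind_repr stabilizer_sub (prod_repr chi' rho'))].

End LittleGroups.

End Representations.

Section RhoTilde.

Variables (F : fieldType) (gT : finGroupType) (G : {group gT}).
Variables (a b c : gT).

Definition tchi (zeta : F) (i : nat) (chi : mx_representation F <[a]>%G 1) :=
  chi a = (zeta ^+ i)%:M.

Definition orbit_chi (zeta : F) (i : nat) (chi : mx_representation F <[a]>%G 1) :=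
  exists2 chi0, tchi zeta i chi0 & in_char_orbit G chi0 chi.

(* In the index [(i, omega, epsilon)], [i] is 0 or 1. *)
Definition rho_lin (x : 'I_2 * F * F) (V : mx_representation F G 1) : Prop :=
  let: (i, omega, epsilon) := x in
  [/\ V a = ((-1) ^+ i)%:M, V b = omega%:M & V c = epsilon%:M].

(* Matrices act on column vectors: column [j] is the image of the [j]-th      *)
(* basis vector, the basis being [e_0, .., e_{s-1}, f_0, .., f_{s-1}].        *)
Definition rho_a (zeta : F) (n k : nat) : 'M[F]_(2 ^ (k - 2) + 2 ^ (k - 2)) :=
  block_mx (diag_mx (\row_j zeta ^+ (5 ^ j * 2 ^ (n - k)))) 0
           0 (diag_mx (\row_j zeta ^- (5 ^ j * 2 ^ (n - k)))).

Definition shift_mx (s : nat) (omega : F) : 'M[F]_s :=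
  \matrix_(i, j) (if (j.+1 < s)%N then (i == j.+1 :> nat)%:R
                  else if i == 0%N :> nat then omega else 0).

Definition rho_b (k : nat) (omega : F) : 'M[F]_(2 ^ (k - 2) + 2 ^ (k - 2)) :=
  block_mx (shift_mx _ omega) 0 0 (shift_mx _ omega).

Definition rho_c (k : nat) : 'M[F]_(2 ^ (k - 2) + 2 ^ (k - 2)) :=
  block_mx 0 1%:M 1%:M 0.

Definition rho_k (zeta : F) (n k : nat) (omega : F)
    (V : mx_representation F G (2 ^ (k - 2) + 2 ^ (k - 2))) : Prop :=
  [/\ V a = rho_a zeta n k, V b = rho_b k omega & V c = rho_c k].

End RhoTilde.

Arguments rho_k {F gT G} a b c zeta n k omega V.

(* Main.v *)
(* A nonzero vector [v] that is an eigenvector of [a] with eigenvalue         *)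
(* [zeta ^+ (2 ^ (n - k))] and of [b ^+ (2 ^ (k - 2))] with eigenvalue        *)
(* [omega] has a [G]-orbit, up to scalars, formed by the [2 ^ (k - 1)]        *)
(* vectors [v b^-j], [v b^-j c]. Their [a]-eigenvalues are distinct, as the   *)
(* powers [+-5^j] are distinct modulo [2 ^ k], so they are linearly           *)
(* independent, and on their span the generators act by the matrices of       *)
(* [rho_k]. As these powers exhaust the units modulo [2 ^ k], every           *)
(* irreducible representation is linear or contains such a vector, so it is   *)
(* one of the candidates [rho_lin], [rho_k], and each occurs at most once.    *)
(* The squares of the degrees of all candidates add up to                     *)
(*   2^n + sum_(2 <= k <= n) 2^(n-k) 4^(k-1) = 2^(2n-1) = #|G|,               *)
(* so all candidates occur, are irreducible, and are pairwise inequivalent.   *)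
(* The representation induced from the little group of [chi] has degree at    *)
(* most [2 ^ (k - 1)] and contains such a vector, hence is the [rho_k] with   *)
(* the same [omega].                                                          *)

Require Import Defs.
From HB Require Import structures.
From mathcomp Require Import all_boot all_order all_fingroup all_algebra.
From mathcomp Require Import all_solvable all_field all_character.
From mathcomp Require Import spectral zify ring reals complex.

Set Implicit Arguments.
Unset Strict Implicit.
Unset Printing Implicit Defensive.

Import GRing.Theory.
Local Open Scope ring_scope.

(** * Powers of 5 modulo powers of 2 *)

(** A representation of [G] is studied through the eigenvalues of [a]. Conjugation by [b] and [c]
    raises [a] to the powers 5^j and -5^j, and these act transitively on the roots of unity of exact
    order 2^k for k >= 2 ([exp5_orbitP]). So an irreducible representation in which [a] has an
    eigenvalue of order 2^k also has the eigenvalue zeta^(2^(n-k)), on an eigenspace stable under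
    b^(2^(k-2)); a common eigenvector of [a] and b^(2^(k-2)) there generates a copy of some [rho_k]
    ([irr_eigenvector], [irr_eigenvector_rho_k]). The eigenvalues 1 and -1 are fixed by all odd
    powers and force degree 1 ([irr_small_eigenvalue_linear]).

    That every candidate occurs is not checked on the matrices. The squared degrees of the
    candidates add up to the order of [G], as do those of the irreducible representations, so the
    injection from irreducible classes to candidates is a bijection ([irr_index_bijective]).
    Existence, irreducibility and inequivalence of the [rho_k] all come from this count.

    For the little groups, the stabilizer of a character in the k-th orbit has index at most
    2^(k-1), and the induced representation contains a vector with the eigenvalues that characterize
    [rho_k], so it is [rho_k] ([ind_rho_k]). Conversely every [omega] comes from a linear character
    of the little group ([rho_k_little_group]). Finally [rho_k] kills a^(2^k), so a faithful
    irreducible representation must have k = n and omega = 1 ([rho_n_faithful],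
    [irr_faithful_rho_n]). *)

Lemma exp5_twoX m q :
  exists2 u, (5 ^ (2 ^ m * q) = 1 + 2 ^ (m + 2) * u)%N & odd u = odd q.
Proof.
elim: m => [|m [u Du odd_u]].
  rewrite mul1n; elim: q => [|q [u Du odd_u]]; first by exists 0%N => //;
    rewrite muln0 addn0.
  exists (5 * u + 1)%N; last by rewrite oddD oddM /= odd_u addbT.
  by rewrite expnS Du; lia.
(* Squaring 1 + 2^(m+2) u gives 1 + 2^(m+3) (u + 2^(m+1) u^2), and the new cofactor has the parity
   of u. *)
exists (u + 2 ^ m.+1 * u ^ 2)%N; last by rewrite oddD oddM oddX /= addbF.
by rewrite expnS -mulnA mulnC expnM Du !expnD !expnS expn0; ring.
Qed.

(** This is the fact that 5 has order exactly 2^m modulo 2^(m+2): for d = 2^m q, one more factor 2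
    divides 5^d - 1 precisely when q is even. *)
Lemma dvdn_exp5_sub1 m d : ((2 ^ (m + 2) %| 5 ^ d - 1) = (2 ^ m %| d))%N.
Proof.
elim: m d => [|m IHm] d.
  have [u] := exp5_twoX 0 d; rewrite expn0 mul1n => -> _.
  by rewrite addKn dvdn_mulr // !dvd1n.
have [/dvdnP[q ->]|Ndv] := boolP (2 ^ m %| d)%N; last first.
  apply/idP/idP=> dv; case/negP: Ndv; last first.
    by apply: dvdn_trans dv; rewrite dvdn_exp2l.
  by rewrite -IHm; apply: dvdn_trans dv; rewrite dvdn_exp2l // leq_add2r.
rewrite mulnC; have [u -> odd_u] := exp5_twoX m q; rewrite addKn.
rewrite addSn !expnSr !dvdn_pmul2l ?expn_gt0 //.
by rewrite !dvdn2 odd_u.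
Qed.


(** * Roots of unity of order 2^(m+2) as one orbit under the powers 5^j and -5^j *)

Section PrimitiveRootOrbit.

Variables (F : fieldType) (m : nat).
Implicit Types y z : F.

Lemma prim_root_exp5 z j : (2 ^ (m + 2)).-primitive_root z ->
  (z ^+ (5 ^ j) == z) = (2 ^ m %| j)%N.
Proof.
move=> prim_z; rewrite -{2}[z]expr1 (eq_prim_root_expr prim_z).
by rewrite eqn_mod_dvd ?expn_gt0 // dvdn_exp5_sub1.
Qed.

Lemma prim_root_exp5_inj z : (2 ^ (m + 2)).-primitive_root z ->
  injective (fun j : 'I_(2 ^ m) => z ^+ (5 ^ j)).
Proof.
move=> prim_z i j; wlog le_ij: i j / (i <= j)%N.
  by move=> IH; case/orP: (leq_total i j) => [/IH|/IH] // IHi /esym/IHi->.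
rewrite -{1}(subnKC le_ij) expnD exprM => /esym/eqP.
rewrite prim_root_exp5; last first.
  by rewrite prim_root_exp_coprime // coprimeXl // coprimeXr.
case: (posnP (j - i)) => [ij0 _|gt_ij /(dvdn_leq gt_ij)].
  by apply/val_inj/eqP; rewrite eqn_leq le_ij -subn_eq0 ij0.
by rewrite leqNgt (leq_ltn_trans (leq_subr i j)).
Qed.

(** Equality would make 5^i + 5^j divisible by 4, but it is 2 modulo 4. *)
Lemma prim_root_exp5_neqV z i j : (2 ^ (m + 2)).-primitive_root z ->
  z ^+ (5 ^ i) != z ^- (5 ^ j).
Proof.
move=> prim_z; have z_neq0: z != 0 by rewrite (prim_root_eq0 prim_z) expn_eq0.
rewrite -(inj_eq (mulIf (expf_neq0 (5 ^ j) z_neq0))) mulVf ?expf_neq0 //.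
rewrite -exprD -(prim_order_dvd prim_z); apply/negP=> dv.
have: (4 %| 5 ^ i + 5 ^ j)%N by apply: dvdn_trans dv; rewrite expnD dvdn_mull.
by rewrite /dvdn -modnDm -!(modnXm _ 4 5) !exp1n.
Qed.

(** Indexed like the diagonal of [rho_a]: first the eigenvalues on the e_j, then those on the
    f_j. *)
Definition exp5_orbit z (x : 'I_(2 ^ m + 2 ^ m)) : F :=
  match split x with
  | inl j => z ^+ (5 ^ j)
  | inr j => z ^- (5 ^ j)
  end.

Lemma exp5_orbit_inj z : (2 ^ (m + 2)).-primitive_root z ->
  injective (exp5_orbit z).
Proof.
move=> prim_z x y; rewrite -[x]splitK -[y]splitK /exp5_orbit !unsplitK.
case: (split x) => i; case: (split y) => j.
- by move/(prim_root_exp5_inj prim_z) ->.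
- by move/eqP; rewrite (negPf (prim_root_exp5_neqV _ _ prim_z)).
- by move/esym/eqP; rewrite (negPf (prim_root_exp5_neqV _ _ prim_z)).
- by move/invr_inj/(prim_root_exp5_inj prim_z) ->.
Qed.

Lemma prim_root_expN1 z : (2 ^ (m + 2)).-primitive_root z ->
  z ^+ (2 ^ m.+1) = -1.
Proof.
move=> prim_z; have := prim_expr_order prim_z.
rewrite addn2 expnSr exprM => /eqP; rewrite sqrf_eq1 => /orP[|/eqP //].
by rewrite -(prim_order_dvd prim_z) addn2 dvdn_Pexp2l // ltnn.
Qed.

(* The orbit consists of [2 ^ m.+1] distinct roots of [X ^ (2 ^ m.+1) + 1],   *)
(* hence of all of them.                                                      *)
Lemma exp5_orbitP z y : (2 ^ (m + 2)).-primitive_root z ->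
  (2 ^ (m + 2)).-primitive_root y -> exists x, y = exp5_orbit z x.
Proof.
move=> prim_z prim_y; apply/codomP; apply: contraT => Ny.
pose p : {poly F} := 'X^(2 ^ m.+1) + 1%:P.
have sz_p: size p = (2 ^ m.+1).+1 by rewrite size_XnaddC ?expn_gt0.
have p_neq0: p != 0 by rewrite -size_poly_eq0 sz_p.
have rootP w : root p w = (w ^+ (2 ^ m.+1) == -1).
  by rewrite /root !hornerE addr_eq0.
have root_all: all (root p) (y :: codom (exp5_orbit z)).
  rewrite /= rootP prim_root_expN1 // eqxx; apply/allP=> _ /codomP[x ->].
  rewrite rootP /exp5_orbit; case: split => j; rewrite ?exprVn;
    rewrite exprAC prim_root_expN1 // -signr_odd oddX orbT ?invrN ?invr1 //.
have uniq_all: uniq (y :: codom (exp5_orbit z)).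
  by rewrite /= Ny; apply/injectiveP; apply: exp5_orbit_inj.
have := max_poly_roots p_neq0 root_all uniq_all.
by rewrite sz_p /= size_codom card_ord expnS mul2n -addnn ltnn.
Qed.

End PrimitiveRootOrbit.

(** * Independence and existence of eigenvectors *)

Lemma row_free_eigenvectors (F : fieldType) m d (A : 'M[F]_d) (E : 'M_(m, d))
    (lam : 'I_m -> F) :
    injective lam -> (forall i, row i E != 0) ->
    (forall i, row i E *m A = lam i *: row i E) ->
  row_free E.
Proof.
move=> lam_inj nzE eigE; rewrite -kermx_eq0; apply/rowV0P=> u /sub_kermxP uE0.
(* Applies the product of the A - lam j for j in r to the relation u E = 0. With r all indices but
   i0, only the i0 term survives. *)
have ann r : \sum_i (u 0 i * \prod_(j <- r) (lam i - lam j)) *: row i E = 0.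
  elim: r => [|j r IHr].
    rewrite -{2}uE0 mulmx_sum_row; apply: eq_bigr => i _.
    by rewrite big_nil mulr1.
  have /eqP := congr1 (fun w => w *m A - lam j *: w) IHr.
  rewrite mul0mx scaler0 subr0 => /eqP E0;
    rewrite -[RHS]E0 mulmx_suml scaler_sumr.
  rewrite -sumrB; apply: eq_bigr => i _.
  rewrite -scalemxAl eigE !scalerA -scalerBl big_cons; congr (_ *: _); ring.
apply/rowP=> i0; rewrite mxE; have := ann (enum (predC1 i0)).
rewrite (bigD1 i0) //= [X in _ + X]big1 ?addr0 => [|i i'i0].
  move/eqP; rewrite scaler_eq0 (negPf (nzE i0)) orbF mulf_eq0 => /orP[/eqP //|].
  rewrite prodf_seq_eq0 => /hasP[j]; rewrite mem_enum !inE => j'i0 /=.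
  by rewrite subr_eq0 => /eqP/lam_inj Dj; rewrite Dj eqxx in j'i0.
rewrite (big_rem i) ?mem_enum //= subrr mul0r mulr0 scale0r //.
Qed.

Lemma eigenvector_stable (F : numClosedFieldType) m d (U : 'M[F]_(m, d))
    (A : 'M_d) :
    U != 0 -> (U *m A <= U)%MS ->
  exists (x : F) (v : 'rV_d), [/\ v != 0, (v <= U)%MS & v *m A = x *: v].
Proof.
move=> nzU stabU; pose B := row_base U.
have sUA: (B *m A <= B)%MS by rewrite (eqmxMr _ (eq_row_base U)) eq_row_base.
have r_gt0: (0 < \rank U)%N by rewrite lt0n mxrank_eq0.
(* The matrix below is that of [A] restricted to [U], in the basis [B]. *)
have [x /eigenvalueP[w wC nz_w]] :=
  eigenvalue_closed (B *m A *m pinvmx B) r_gt0.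
exists x, (w *m B); split.
- by rewrite -mxrank_eq0 mxrankMfree ?row_base_free // mxrank_eq0.
- by rewrite -(eq_row_base U) submxMl.
by rewrite -mulmxA -{1}(mulmxKpV sUA) mulmxA wC scalemxAl.
Qed.

(** * Eigenvectors, bases and induced representations *)

(** The counting principle behind the classification: a missed [j] would contribute positive weight
    beyond the total of the image. The weights will be squared degrees. *)
Lemma injective_weight_surj (I J : finType) (f : I -> J) (wI : I -> nat)
    (wJ : J -> nat) :
    injective f -> (forall i, wJ (f i) = wI i) -> (forall j, (0 < wJ j)%N) ->
    (\sum_j wJ j <= \sum_i wI i)%N ->
  forall j, exists i, f i = j.
Proof.
move=> f_inj wf wJ_gt0 le_w j.
suffices /codomP[i ->]: j \in codom f by exists i.
apply: contraLR le_w => Nj; rewrite -ltnNge.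
have ->: (\sum_i wI i = \sum_(j in codom f) wJ j)%N.
  rewrite -big_uniq /=; last exact/injectiveP.
  by rewrite big_map big_enum; apply: eq_bigr.
rewrite [ltnRHS](bigID (mem (codom f))) /= -addn1 leq_add2l.
by rewrite (bigD1 j) //= ltn_addr.
Qed.

Section Representations.

Variables (F : fieldType) (gT : finGroupType) (G : {group gT}).

Lemma repr_eq_gen d (V W : mx_representation F G d) (S : {set gT}) :
  G :=: <<S>>%g -> {in S, V =1 W} -> {in G, V =1 W}.
Proof.
move=> defG eqS; pose E := [set x in G | V x == W x].
have grE: group_set E.
  apply/group_setP; split=> [|x y]; first by rewrite inE group1 !repr_mx1 eqxx.
  rewrite !inE => /andP[Gx /eqP Ex] /andP[Gy /eqP Ey].
  by rewrite groupM // !repr_mxM // Ex Ey eqxx.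
have sGE: G \subset Group grE.
  rewrite {1}defG gen_subG; apply/subsetP=> x Sx.
  by rewrite inE /= {1}defG mem_gen //= eqS.
by move=> x /(subsetP sGE); rewrite inE => /andP[_ /eqP].
Qed.

Lemma eq_mx_rsim d (V W : mx_representation F G d) :
  {in G, V =1 W} -> mx_rsim V W.
Proof.
move=> eqVW; exists 1%:M; rewrite ?row_free_unit ?unitmx1 // => x Gx.
by rewrite mulmx1 mul1mx eqVW.
Qed.

Lemma mx_rsim1_eq (V W : mx_representation F G 1) :
  mx_rsim V W -> {in G, V =1 W}.
Proof.
move=> simVW x Gx; rewrite [V x]mx11_scalar.
by rewrite (mx_rsim_scalar Gx simVW (mx11_scalar _)).
Qed.

Lemma scalemx_eqI m d (v : 'M[F]_(m, d)) x y : v != 0 -> x *: v = y *: v ->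
  x = y.
Proof.
move=> nz_v /eqP; rewrite -subr_eq0 -scalerBl scalemx_eq0 (negPf nz_v) orbF.
by rewrite subr_eq0 => /eqP.
Qed.

Section Eigenvectors.

Variables (d m : nat) (W : mx_representation F G d) (v : 'M[F]_(m, d)).

Lemma repr_eigenX x lam i : x \in G -> v *m W x = lam *: v ->
  v *m W (x ^+ i)%g = lam ^+ i *: v.
Proof.
move=> Gx vx; elim: i => [|i IHi]; first by rewrite repr_mx1 mulmx1 scale1r.
by rewrite expgSr repr_mxM ?groupX // mulmxA IHi -scalemxAl vx scalerA exprSr.
Qed.

Lemma repr_eigen_unity x lam i : v != 0 -> x \in G -> v *m W x = lam *: v ->
  (x ^+ i = 1)%g -> lam ^+ i = 1.
Proof.
move=> nz_v Gx /(repr_eigenX i Gx) vxi xi1; apply: scalemx_eqI nz_v _.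
by rewrite -vxi xi1 repr_mx1 mulmx1 scale1r.
Qed.

Lemma repr_eigenV x lam : x \in G -> lam != 0 -> v *m W x = lam *: v ->
  v *m W (x^-1)%g = lam^-1 *: v.
Proof.
move=> Gx nz_lam vx; apply: (row_free_inj (repr_mx_free W Gx)).
by rewrite -mulmxA -repr_mxM ?groupV // mulVg repr_mx1 mulmx1 -scalemxAl vx
  scalerA mulVf ?scale1r.
Qed.

Lemma repr_eigenJ x y lam : x \in G -> y \in G ->
    v *m W (x ^ y)%g = lam *: v ->
  v *m W (y^-1)%g *m W x = lam *: (v *m W (y^-1)%g).
Proof.
move=> Gx Gy vxy; rewrite scalemxAl -vxy -!mulmxA -!repr_mxM ?groupV ?groupJ //.
by rewrite conjgE -!mulgA mulgV mulg1.
Qed.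

End Eigenvectors.

(** By [repr_eigenJ], y^-1 maps the eigenspace into itself; that is enough because [rstabs] is a
    group. *)
Lemma rstabs_eigenspace d (W : mx_representation F G d) x y lam i :
    x \in G -> y \in G -> (x ^ y = x ^+ i)%g -> lam ^+ i = lam ->
  y \in rstabs W (eigenspace (W x) lam).
Proof.
move=> Gx Gy xy lam_i; rewrite -groupV inE groupV Gy /=.
apply/eigenspaceP; apply: repr_eigenJ => //.
by rewrite xy -[X in _ = X *: _]lam_i; apply: repr_eigenX => //;
  apply/eigenspaceP.
Qed.

(** Freeness of the m rows gives m <= d, so the degree bound makes [E] a basis, and [W] can be
    rewritten in it. *)
Lemma repr_in_basis d m (W : mx_representation F G d) (E : 'M_(m, d)) :
    row_free E -> (d <= m)%N ->
  exists2 V : mx_representation F G m, mx_rsim W V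
    & forall x A, E *m W x = A *m E -> V x = A.
Proof.
move=> freeE le_dm; have Dd: d = m.
  by apply/eqP; rewrite eqn_leq le_dm -(eqP freeE) rank_leq_col.
rewrite {le_dm}Dd in W E freeE *.
have uE: E \in unitmx by rewrite -row_free_unit.
exists (rconj_repr W uE) => [|x A EA]; last by rewrite rconj_mxE EA mulmxK.
exists (invmx E); rewrite ?row_free_unit ?unitmx_inv // => x Gx.
by rewrite rconj_mxE -mulmxA mulKmx.
Qed.

Lemma eigenvector_repr (H : {group gT}) d (W : mx_representation F G d)
    (v : 'rV_d) :
    H \subset G -> v != 0 -> {in H, forall x, (v *m W x <= v)%MS} ->
  exists chi : mx_representation F H 1, {in H, forall x, v *m W x = chi x *m v}.
Proof.
move=> /subsetP sHG nz_v stab_v; pose f x := v *m W x *m pinvmx v.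
have fE x : x \in H -> v *m W x = f x *m v.
  by move=> Hx; rewrite mulmxKpV ?stab_v.
have free_v: row_free v by rewrite -row_leq_rank lt0n mxrank_eq0.
have f_repr: mx_repr H f.
  split=> [|x y Hx Hy]; apply: (row_free_inj free_v).
    by rewrite -fE // repr_mx1 mulmx1 mul1mx.
  by rewrite -fE ?groupM // repr_mxM ?sHG // mulmxA fE // -mulmxA fE // mulmxA.
by exists (MxRepresentation f_repr).
Qed.

Lemma prim_rootV m (z : F) : m.-primitive_root z -> m.-primitive_root z^-1.
Proof.
case/andP=> m_gt0 /forallP prim_z; apply/andP; split=> //; apply/forallP=> i.
by have := prim_z i; rewrite !unity_rootE exprVn invr_eq1.
Qed.

(* The block row of the coset [H] itself. *)
Lemma ind_repr_embed (H : {group gT}) m (W : mx_representation F H m)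
    (sHG : H \subset G) :
  exists2 E : 'M_(m, \sum_(i < #|rcosets H G|) m), row_free E
    & {in H, forall x, E *m ind_repr sHG W x = W x *m E}.
Proof.
have HG : (H :* 1)%g \in rcosets H G by rewrite mem_rcosets mulSGid // group1.
pose i0 := enum_rank_in HG (H :* 1)%g.
have Hr : rcoset_rep i0 \in H.
  have [_ _ [_ Di0]] := rcoset_repP i0.
  have: rcoset_rep i0 \in (H :* rcoset_rep i0)%g by apply: rcoset_refl.
  by rewrite Di0 enum_rankK_in // rcoset1.
have repE j : (rcoset_rep j \in H) = (j == i0).
  apply/idP/eqP=> [Hj | -> //]; apply: enum_val_inj.
  have [_ _ [_ <-]] := rcoset_repP j; rewrite enum_rankK_in // rcoset1.
  by rewrite rcoset_id.
set r := rcoset_rep i0 in Hr.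
exists (\mxrow_j (if j == i0 then W (r^-1)%g else 0)) => [|x Hx].
  apply/row_freeP; exists (\mxcol_j (if j == i0 then W r else 0)).
  rewrite mul_mxrow_mxcol (bigD1 i0) //= eqxx big1 => [|j /negPf->]; last first.
    by rewrite mul0mx.
  by rewrite addr0 -repr_mxM ?groupV // mulVg repr_mx1.
rewrite mul_mxrow_mxblock mul_mxrow; apply: eq_mxrow => j /=.
rewrite (bigD1 i0) //= eqxx big1 ?addr0 => [|i /negPf->]; last first.
  by rewrite mul0mx.
rewrite -/r groupMl ?groupM // groupV repE; case: eqP => [->|_]; last first.
  by rewrite !mulmx0.
by rewrite -/r -!repr_mxM ?groupM ?groupV // !mulgA mulVg mul1g.
Qed.

(** Turns a parametrization into a count, by means of an enumeration [e] of the parameters by a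
    finite type. *)
Lemma num_repr_classes_parametrized
    (P : forall d, mx_representation F G d -> Prop) (T : Type) (X : T -> Prop)
    (m : nat) (rho : T -> mx_representation F G m -> Prop) (I : finType)
    (e : I -> T) :
    parametrized_by P X rho ->
    (forall x V W, rho x V -> rho x W -> mx_rsim V W) ->
    injective e -> (forall i, X (e i)) ->
    (forall x, X x -> exists i, x = e i) ->
  num_repr_classes P #|I|.
Proof.
case=> exV PV injV surjV uniqV e_inj Xe Xsurj.
have [r rP] := fin_all_exists (fun i => exV (e i) (Xe i)).
exists (fun=> m), (fun i => r (enum_val i)); split=> [i | i j | d W PW].
- exact: PV (rP _).
- move/(injV _ _ _ _ (Xe _) (Xe _) (rP _) (rP _))/e_inj; exact: enum_val_inj.
have [x [V [Xx rhoV simWV]]] := surjV d W PW.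
have [i Di] := Xsurj x Xx; exists (enum_rank i); rewrite enum_rankK.
by apply: mx_rsim_trans simWV _; apply: uniqV (rP i); rewrite -Di.
Qed.

End Representations.

(** * The presentation *)

Section Presentation.

Local Open Scope group_scope.

Variables (gT : finGroupType) (G : {group gT}) (a b c : gT).
Hypotheses (genG : G :=: <<[set a; b; c]>>) (c_exp : c ^+ 2 = 1).
Hypotheses (conj_ab : a ^ b = a ^+ 5) (conj_ac : a ^ c = a^-1).
Hypothesis conj_bc : b ^ c = b.

Lemma gen_a : a \in G. Proof. by rewrite genG mem_gen // !inE eqxx. Qed.
Lemma gen_b : b \in G. Proof. by rewrite genG mem_gen // !inE eqxx orbT. Qed.
Lemma gen_c : c \in G. Proof. by rewrite genG mem_gen // !inE eqxx !orbT. Qed.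

Lemma conj_a_bX j : a ^ (b ^+ j) = a ^+ (5 ^ j).
Proof.
elim: j => [|j IHj]; first by rewrite conjg1.
by rewrite expgSr conjgM IHj conjXg conj_ab -expgM -expnS.
Qed.

Lemma bc_subgroup : <<[set b; c]>> = <[b]> * <[c]>.
Proof.
rewrite -cent_joinEr ?joing_idl ?joing_idr // cent_cycle cycle_subG.
by apply/cent1P/commute_sym/commgP/conjg_fixP.
Qed.

Lemma bc_subgroupP x : reflect (exists j, exists e : bool, x = b ^+ j * c ^+ e)
  (x \in <<[set b; c]>>).
Proof.
rewrite bc_subgroup; apply: (iffP mulsgP) => [|[j [e ->]]]; last first.
  by exists (b ^+ j) (c ^+ e); rewrite ?mem_cycle.
case=> _ _ /cycleP[j ->] /cycleP[e ->] ->; exists j, (odd e).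
rewrite -{1}(odd_double_half e) addnC -muln2 mulnC expgD expgM c_exp.
by rewrite expg1n mul1g.
Qed.

Lemma a_norm : G \subset 'N(<[a]>).
Proof.
rewrite genG gen_subG; apply/subsetP=> x; rewrite !inE -cycleJ.
case/orP=> [/orP[]|] /eqP->.
- by rewrite conjgE mulKg.
- by rewrite conj_ab cycleX.
by rewrite conj_ac cycleV.
Qed.

Lemma normal_form x : x \in G ->
  exists i, exists2 y, y \in <<[set b; c]>> & x = a ^+ i * y.
Proof.
have sKG: <<[set b; c]>> \subset G.
  rewrite gen_subG; apply/subsetP=> y; rewrite !inE.
  by case/orP=> /eqP->; rewrite (gen_b, gen_c).
have ->: G = <[a]> * <<[set b; c]>> :> {set gT}.
  rewrite -norm_joinEr; last exact: subset_trans sKG a_norm.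
  by rewrite joing_idl joing_idr genG joingE setUA.
by case/mulsgP=> _ y /cycleP[i ->] Ky ->; exists i, y.
Qed.

End Presentation.

(** * The matrices of [rho_k] *)

Lemma row_mul_diag (F : fieldType) m d (r : 'rV[F]_m) (A : 'M_(m, d)) i :
  row i (diag_mx r *m A) = r 0 i *: row i A.
Proof. by apply/rowP=> j; rewrite mul_diag_mx !mxE. Qed.

Section RhoK.

Variables (F : fieldType) (n : nat) (gT : finGroupType) (G : {group gT}).
Variables (a b c : gT).
Hypotheses (genG : (G :=: <<[set a; b; c]>>)%g) (c_exp : (c ^+ 2 = 1)%g).
Hypotheses (conj_ab : (a ^ b = a ^+ 5)%g) (conj_ac : (a ^ c = a^-1)%g).
Hypothesis conj_bc : (b ^ c = b)%g.
Variable zeta : F.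
Hypothesis hzeta : (2 ^ n).-primitive_root zeta.

Let Ga : a \in G. Proof. exact: gen_a genG. Qed.
Let Gb : b \in G. Proof. exact: gen_b genG. Qed.
Let Gc : c \in G. Proof. exact: gen_c genG. Qed.

Lemma prim_orbit_root k : (2 <= k <= n)%N ->
  (2 ^ (k - 2 + 2)).-primitive_root (zeta ^+ (2 ^ (n - k))).
Proof.
move=> /andP[k_ge2 le_kn]; rewrite subnK //.
have -> : (2 ^ (n - k) = 2 ^ n %/ 2 ^ k)%N by rewrite -expnB.
by rewrite dvdn_prim_root // dvdn_exp2l.
Qed.

Lemma eq_rho_k k omega
    (V W : mx_representation F G (2 ^ (k - 2) + 2 ^ (k - 2))) :
  rho_k a b c zeta n k omega V -> rho_k a b c zeta n k omega W -> mx_rsim V W.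
Proof.
case=> Va Vb Vc [Wa Wb Wc]; apply/eq_mx_rsim/(repr_eq_gen genG) => x.
by rewrite !inE => /orP[/orP[]|] /eqP->; rewrite ?Va ?Vb ?Vc ?Wa ?Wb ?Wc.
Qed.

Lemma eq_rho_lin x (V W : mx_representation F G 1) :
  rho_lin a b c x V -> rho_lin a b c x W -> mx_rsim V W.
Proof.
case: x => [[i omega] e] [Va Vb Vc] [Wa Wb Wc].
apply/eq_mx_rsim/(repr_eq_gen genG) => x.
by rewrite !inE => /orP[/orP[]|] /eqP->; rewrite ?Va ?Vb ?Vc ?Wa ?Wb ?Wc.
Qed.

Lemma row_rho_a_mul k d (E : 'M_(_, d)) i :
  row i (rho_a zeta n k *m E) = exp5_orbit (zeta ^+ (2 ^ (n - k))) i *: row i E.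
Proof.
rewrite -[E]vsubmxK mul_block_col !mul0mx addr0 add0r /exp5_orbit.
case: (split_ordP i) => j ->; rewrite ?rowKu ?rowKd row_mul_diag mxE;
  by rewrite mulnC exprM.
Qed.

Section EigenvectorBasis.

Variables (k : nat) (omega : F) (d : nat) (W : mx_representation F G d).
Variable v : 'rV[F]_d.
Hypothesis k_range : (2 <= k <= n)%N.
Let s := (2 ^ (k - 2))%N.
Let lam := zeta ^+ (2 ^ (n - k)).
Hypotheses (nz_v : v != 0) (v_a : v *m W a = lam *: v).
Hypothesis v_bs : v *m W (b ^+ s)%g = omega *: v.

(** Representations act on row vectors from the right, and b^-j a = a^(5^j) b^-j; hence the inverse
    powers of [b], which give v b^-j the eigenvalue lam^(5^j). *)
Definition orbit_basis : 'M[F]_(s + s, d) :=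
  let E := \matrix_(j < s) (v *m W (b ^- j)%g) in col_mx E (E *m W c).

Let E1 := \matrix_(j < s) (v *m W (b ^- j)%g).

Lemma orbit_basis_half_a :
  E1 *m W a = diag_mx (\row_j zeta ^+ (5 ^ j * 2 ^ (n - k))) *m E1.
Proof.
apply/row_matrixP=> j; rewrite row_mul_diag row_mul rowK mxE -mulmxA.
rewrite -repr_mxM ?groupV ?groupX //.
have ->: (b ^- j * a = a ^+ (5 ^ j) * b ^- j)%g.
  by rewrite -(conj_a_bX conj_ab) conjgE -!mulgA mulgV mulg1.
rewrite repr_mxM ?groupV ?groupX // mulmxA (repr_eigenX _ Ga v_a) -scalemxAl.
by rewrite mulnC exprM.
Qed.

(** Needed for the second half of the basis: since c a = a^-1 c, the action of [a] on the rows of E1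
    c is that of a^-1 on the rows of E1. *)
Lemma orbit_basis_half_aV :
  E1 *m W (a^-1)%g = diag_mx (\row_j zeta ^- (5 ^ j * 2 ^ (n - k))) *m E1.
Proof.
set D := diag_mx (\row_j zeta ^+ (5 ^ j * 2 ^ (n - k))) : 'M[F]_s.
have nz_zeta: zeta != 0.
  by rewrite (prim_root_eq0 hzeta) expn_eq0.
have DV: diag_mx (\row_j zeta ^- (5 ^ j * 2 ^ (n - k))) *m D = 1%:M :> 'M[F]_s.
  rewrite mulmx_diag -diag_const_mx; congr diag_mx; apply/rowP=> j.
  by rewrite !mxE mulVf // expf_neq0.
apply: (row_free_inj (repr_mx_free W Ga)).
by rewrite -!mulmxA orbit_basis_half_a [in RHS]mulmxA DV -repr_mxM ?groupV //
  mulVg repr_mx1 mulmx1 mul1mx.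
Qed.

Lemma orbit_basis_a : orbit_basis *m W a = rho_a zeta n k *m orbit_basis.
Proof.
rewrite mul_col_mx mul_block_col !mul0mx addr0 add0r -/E1.
rewrite orbit_basis_half_a mulmxA -orbit_basis_half_aV -!mulmxA.
rewrite -!repr_mxM ?groupV //; congr (col_mx _ (_ *m W _)).
have cV: (c^-1 = c)%g by apply/eqP; rewrite eq_invg_mul -expg2 c_exp.
by rewrite -conj_ac conjgE cV -!mulgA -expg2 c_exp mulg1.
Qed.

Lemma orbit_basis_half_b : E1 *m W b = shift_mx _ omega *m E1.
Proof.
apply/row_matrixP=> i; rewrite !row_mul rowK [RHS]mulmx_sum_row -mulmxA.
rewrite -repr_mxM ?groupV ?groupX //.
have s_gt0: (0 < s)%N by rewrite expn_gt0.
case: i => [[|i] lt_i].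
  (* Row 0 wraps around: v b = omega v b^-(s-1), because b^s acts on v by omega. *)
  have lt_s: (s.-1 < s)%N by rewrite prednK.
  rewrite (bigD1 (Ordinal lt_s)) //= big1 ?addr0 => [|j j_neq]; last first.
    rewrite !mxE; case: ltnP => [_|le_sj]; first by rewrite scale0r.
    case/eqP: j_neq; apply/val_inj/eqP; rewrite /= -eqSS prednK // eqn_leq.
    by rewrite le_sj ltn_ord.
  rewrite rowK !mxE /= prednK // ltnn ?expg0 invg1 mul1g.
  rewrite scalemxAl -v_bs -mulmxA -repr_mxM ?groupV ?groupX //.
  by rewrite -{1}(prednK s_gt0) expgS mulgK.
have lt_is: (i < s)%N by apply: ltnW.
rewrite (bigD1 (Ordinal lt_is)) //= big1 ?addr0 => [|j j_neq]; last first.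
  rewrite !mxE /= eqSS; case: ltnP => [_|_]; last by rewrite scale0r.
  case: eqP => [Dj|]; last by rewrite scale0r.
  by case/eqP: j_neq; apply: val_inj.
by rewrite rowK !mxE /= lt_i eqxx scale1r expgS invMg mulgKV.
Qed.


Lemma orbit_basis_b : orbit_basis *m W b = rho_b k omega *m orbit_basis.
Proof.
rewrite mul_col_mx mul_block_col !mul0mx addr0 add0r -/E1.
rewrite mulmxA -orbit_basis_half_b -!mulmxA -!repr_mxM //.
congr (col_mx _ (_ *m W _)).
by rewrite -{1}conj_bc conjgE !mulgA mulgV mul1g.
Qed.

Lemma orbit_basis_c : orbit_basis *m W c = rho_c F k *m orbit_basis.
Proof.
rewrite mul_col_mx mul_block_col !mul0mx !mul1mx addr0 add0r.
by rewrite -mulmxA -repr_mxM // -expg2 c_exp repr_mx1 mulmx1.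
Qed.

Lemma orbit_basis_free : row_free orbit_basis.
Proof.
apply: (row_free_eigenvectors (A := W a)
          (exp5_orbit_inj (prim_orbit_root k_range))) => i.
  have nz_vW x : x \in G -> v *m W x != 0.
    move=> Gx; rewrite -mxrank_eq0 mxrankMfree ?mxrank_eq0 //.
    exact: repr_mx_free.
  case: (split_ordP i) => j ->; rewrite ?rowKu ?rowKd ?row_mul rowK.
    by rewrite nz_vW // groupV groupX.
  by rewrite -mulmxA -repr_mxM ?nz_vW ?groupM ?groupV ?groupX.
by rewrite -row_mul orbit_basis_a row_rho_a_mul.
Qed.

Lemma orbit_basis_module : mxmodule W orbit_basis.
Proof.
rewrite /mxmodule {1}genG gen_subG; apply/subsetP=> x.
rewrite !inE => /orP[/orP[]|] /eqP->.
- by rewrite Ga orbit_basis_a submxMl.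
- by rewrite Gb orbit_basis_b submxMl.
by rewrite Gc orbit_basis_c submxMl.
Qed.

(** Assuming a degree bound instead of irreducibility makes this apply to induced representations,
    whose degree is bounded by the index of the stabilizer. *)
Lemma eigenvector_rho_k : (d <= s + s)%N ->
  exists2 V, rho_k a b c zeta n k omega V & mx_rsim W V.
Proof.
move=> le_d; have [V simWV VE] := repr_in_basis W orbit_basis_free le_d.
exists V => //; split; apply: VE.
- exact: orbit_basis_a.
- exact: orbit_basis_b.
exact: orbit_basis_c.
Qed.

Lemma irr_eigenvector_rho_k : mx_irreducible W ->
  exists2 V, rho_k a b c zeta n k omega V & mx_rsim W V.
Proof.
move=> /mx_irrP[_ minW]; apply: eigenvector_rho_k.
(* The span of the orbit is a nonzero submodule, hence everything, which bounds d by the number s +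
   s of rows. *)
have nzE: <<orbit_basis>>%MS != 0.
  rewrite -mxrank_eq0 genmxE (eqP orbit_basis_free) -lt0n addn_gt0.
  by rewrite expn_gt0.
have := minW <<orbit_basis>>%MS; rewrite (eqmx_module _ (genmxE _)).
move/(_ orbit_basis_module nzE); rewrite /row_full genmxE => /eqP <-.
exact: rank_leq_row.
Qed.

End EigenvectorBasis.
End RhoK.

(** * Classification by counting *)

Lemma sum_exp2 m : (\sum_(i < m) 2 ^ i = 2 ^ m - 1)%N.
Proof. by rewrite subn1 predn_exp mul1n. Qed.

Section Classification.

Variables (F : numClosedFieldType) (n : nat).
Variables (gT : finGroupType) (G : {group gT}) (a b c : gT).
Hypotheses (n_ge3 : (3 <= n)%N) (genG : (G :=: <<[set a; b; c]>>)%g).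
Hypotheses (a_exp : (a ^+ (2 ^ n) = 1)%g) (b_exp : (b ^+ (2 ^ (n - 2)) = 1)%g).
Hypotheses (c_exp : (c ^+ 2 = 1)%g).
Hypotheses (conj_ab : (a ^ b = a ^+ 5)%g) (conj_ac : (a ^ c = a^-1)%g).
Hypothesis conj_bc : (b ^ c = b)%g.
Hypothesis oG : #|G| = (2 ^ n * 2 ^ (n - 1))%N.
Variable zeta : F.
Hypothesis hzeta : (2 ^ n).-primitive_root zeta.

Let Ga : a \in G. Proof. exact: gen_a genG. Qed.
Let Gb : b \in G. Proof. exact: gen_b genG. Qed.
Let Gc : c \in G. Proof. exact: gen_c genG. Qed.

Lemma sign_exponent (x : F) : x = 1 \/ x = -1 -> exists u : 'I_2, x = (-1) ^+ u.
Proof. by case=> ->; [exists 0 | exists 1]. Qed.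

(** The commutator of [a] and [c] is a^-2, and a representation of degree 1 kills the derived
    subgroup. *)
Lemma repr1_a2_rker (V : mx_representation F G 1) : (a ^+ 2)%g \in rker V.
Proof.
apply: (subsetP (rker_linear V erefl)); rewrite -groupV -expgVn expg2.
by rewrite -{2}conj_ac mem_commg.
Qed.

Lemma repr1_rho_lin (V : mx_representation F G 1) :
  exists2 x, rho_lin a b c x V &
    x.1.2 ^+ (2 ^ (n - 2)) = 1 /\ (x.2 = 1 \/ x.2 = -1).
Proof.
have val x : 1%:M *m V x = V x 0 0 *: 1%:M.
  by rewrite mul1mx scale_scalar_mx mulr1 -mx11_scalar.
have nz1 : 1%:M != 0 :> 'M[F]_1 by rewrite oner_neq0.
have unity := repr_eigen_unity nz1 _ (val _).
have Vc: V c 0 0 = 1 \/ V c 0 0 = -1.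
  by have /eqP := unity _ _ Gc c_exp; rewrite sqrf_eq1 => /orP[] /eqP;
    [left|right].
have Va: V a 0 0 = 1 \/ V a 0 0 = -1.
  suffices /eqP: V a 0 0 ^+ 2 = 1.
    by rewrite sqrf_eq1 => /orP[] /eqP; [left|right].
  have := repr_eigenX 2 Ga (val a); have [_ ->] := rkerP (repr1_a2_rker V).
  by rewrite mulmx1 => /matrixP/(_ 0 0); rewrite !mxE mulr1.
have [i Di] := sign_exponent Va.
exists (i, V b 0 0, V c 0 0); rewrite //=.
  by split; rewrite -?Di -mx11_scalar.
by split=> //; apply: unity.
Qed.

Lemma irr_eigenvector_linear d (W : mx_representation F G d) (v : 'rV_d) x y w :
    mx_irreducible W -> v != 0 ->
    [/\ v *m W a = x *: v, v *m W b = y *: v & v *m W c = w *: v] ->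
  d = 1%N.
Proof.
move=> /mx_irrP[_ minW] nz_v [va vb vc].
have modv: mxmodule W (<<v>>%MS).
  rewrite (eqmx_module _ (genmxE _)) /mxmodule {1}genG gen_subG.
  apply/subsetP=> z; rewrite !inE => /orP[/orP[]|] /eqP->.
  - by rewrite Ga va scalemx_sub.
  - by rewrite Gb vb scalemx_sub.
  by rewrite Gc vc scalemx_sub.
have nz_v1: <<v>>%MS != 0 by rewrite -mxrank_eq0 genmxE mxrank_eq0.
by have /eqP := minW _ modv nz_v1; rewrite genmxE rank_rV nz_v => <-.
Qed.

(** The eigenvalue x is fixed by odd powers, so [b] and [c] preserve its eigenspace. As they
    commute, they have a common eigenvector there, and its line is a submodule. *)
Lemma irr_small_eigenvalue_linear d (W : mx_representation F G d)
    (v : 'rV_d) x :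
    mx_irreducible W -> v != 0 -> v *m W a = x *: v -> x ^+ 2 = 1 -> d = 1%N.
Proof.
move=> irrW nz_v va x2.
(* Writes a^-1 as an odd natural power, the form that [rstabs_eigenspace] accepts. *)
have a_c: (a ^ c = a ^+ (2 ^ n).-1)%g.
  apply: (mulgI a); rewrite conj_ac mulgV -expgS prednK ?expn_gt0 //.
have x_odd i : odd i -> x ^+ i = x.
  move=> odd_i; rewrite -(odd_double_half i) odd_i exprD -mul2n exprM x2.
  by rewrite expr1n mulr1.
pose U := eigenspace (W a) x.
have nzU: U != 0.
  by apply: contraNneq nz_v => U0; rewrite -submx0 -U0; apply/eigenspaceP.
have Ub: b \in rstabs W U by apply: rstabs_eigenspace conj_ab (x_odd _ _).
have Uc: c \in rstabs W U.
  apply: rstabs_eigenspace a_c (x_odd _ _) => //.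
  by rewrite -subn1 oddB ?expn_gt0 // oddX; case: (n) n_ge3.
have [_ sUb] := setIdP Ub; have [_ sUc] := setIdP Uc.
have [y [v1 [nz_v1 sv1U v1b]]] := eigenvector_stable nzU sUb.
pose V := eigenspace (W b) y.
have Vc: c \in rstabs W V by apply: (@rstabs_eigenspace _ _ _ _ _ _ _ _ 1%N).
have [_ sVc] := setIdP Vc.
have nzUV: (U :&: V)%MS != 0.
  apply: contraNneq nz_v1 => UV0; rewrite -submx0 -UV0 sub_capmx sv1U.
  exact/eigenspaceP.
have sUVc: ((U :&: V)%MS *m W c <= U :&: V)%MS.
  rewrite sub_capmx (submx_trans (submxMr _ (capmxSl _ _)) sUc).
  exact: submx_trans (submxMr _ (capmxSr _ _)) sVc.
have [w [v2 [nz_v2 sv2 v2c]]] := eigenvector_stable nzUV sUVc.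
move: sv2; rewrite sub_capmx => /andP[/eigenspaceP v2a /eigenspaceP v2b].
exact: irr_eigenvector_linear irrW nz_v2 (And3 v2a v2b v2c).
Qed.

Lemma irr_eigenvector d (W : mx_representation F G d) : mx_irreducible W ->
  d = 1%N \/ exists k omega (v : 'rV_d),
    [/\ (2 <= k <= n)%N, v != 0, v *m W a = zeta ^+ (2 ^ (n - k)) *: v
      & v *m W (b ^+ (2 ^ (k - 2)))%g = omega *: v].
Proof.
move=> irrW; have [d_gt0 _] := (mx_irrP W).1 irrW.
have nz1: 1%:M != 0 :> 'M[F]_d by rewrite -mxrank_eq0 mxrank1 -lt0n.
have [x [v [nz_v _ va]]] := eigenvector_stable nz1 (submx1 (1%:M *m W a)).
have xn := repr_eigen_unity nz_v Ga va a_exp.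
have [m prim_x] := prim_order_exists (expn_gt0 2 n) xn.
case/(dvdn_pfactor _ _ (isT : prime 2)) => k le_kn Dm; rewrite {m}Dm in prim_x.
have [k_lt2 | k_ge2] := ltnP k 2.
  left; apply: irr_small_eigenvalue_linear irrW nz_v va _.
  apply/eqP; rewrite -(prim_order_dvd prim_x).
  by case: k k_lt2 {le_kn prim_x} => [|[|]].
have k_range: (2 <= k <= n)%N by rewrite k_ge2.
right; exists k.
have prim_lam := prim_orbit_root hzeta k_range.
set lam := zeta ^+ _ in prim_lam.
rewrite -(subnK k_ge2) in prim_x.
(* Both x and lam have order 2^k, so some conjugate of [a] has the eigenvalue lam on v; translating
   v by y^-1 then gives a lam-eigenvector of [a] itself. *)
have [y Gy vay]: exists2 y, y \in G & v *m W (a ^ y)%g = lam *: v.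
  have [i ->] := exp5_orbitP prim_x prim_lam.
  rewrite /exp5_orbit; case: split => j.
    exists (b ^+ j)%g; rewrite ?groupX // (conj_a_bX conj_ab).
    exact: repr_eigenX.
  exists (b ^+ j * c)%g; rewrite ?groupM ?groupX // conjgM (conj_a_bX conj_ab).
  rewrite conjXg conj_ac expgVn; apply: repr_eigenV; rewrite ?groupX //.
    by rewrite expf_neq0 // (prim_root_eq0 prim_x) expn_eq0.
  exact: repr_eigenX.
pose U := eigenspace (W a) lam.
have nzU: U != 0.
  apply: contraNneq nz_v => U0.
  rewrite -mxrank_eq0 -(mxrankMfree _ (repr_mx_free W (groupVr Gy))) mxrank_eq0.
  rewrite -submx0 -U0; apply/eigenspaceP; exact: repr_eigenJ.
pose s := (2 ^ (k - 2))%N.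
(* Here 5^s is 1 modulo 2^k, so lam is fixed by this power. *)
have Us: (b ^+ s)%g \in rstabs W U.
  apply: rstabs_eigenspace (conj_a_bX conj_ab s) _; rewrite ?groupX //.
  by apply/eqP; rewrite (prim_root_exp5 _ prim_lam).
have [_ sUs] := setIdP Us.
have [omega [u [nz_u /eigenspaceP ua us]]] := eigenvector_stable nzU sUs.
by exists omega, u.
Qed.

(** The power 2^(n-k) of b^(2^(k-2)) is b^(2^(n-2)) = 1. Stated for any [H], as it also serves for
    representations of the little group. *)
Lemma eigenvalue_bX_unity k omega (H : {group gT}) d
    (W : mx_representation F H d) m (v : 'M_(m, d)) :
    (2 <= k <= n)%N -> (b ^+ (2 ^ (k - 2)))%g \in H -> v != 0 ->
    v *m W (b ^+ (2 ^ (k - 2)))%g = omega *: v ->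
  omega ^+ (2 ^ (n - k)) = 1.
Proof.
case/andP=> k_ge2 le_kn Hbs nz_v vb; apply: repr_eigen_unity nz_v Hbs vb _.
by rewrite -expgM -expnD addnC addnBA // subnK.
Qed.

Lemma irr_classification d (W : mx_representation F G d) : mx_irreducible W ->
  d = 1%N \/ exists k omega, [/\ (2 <= k <= n)%N, omega ^+ (2 ^ (n - k)) = 1
    & exists2 V, rho_k a b c zeta n k omega V & mx_rsim W V].
Proof.
move=> irrW; have [|[k [omega [v [k_range nz_v va vb]]]]] :=
  irr_eigenvector irrW.
  by left.
right; exists k, omega; split=> //.
  by apply: eigenvalue_bX_unity k_range _ nz_v vb; rewrite groupX.
exact: (irr_eigenvector_rho_k genG c_exp conj_ab conj_ac conj_bc hzeta k_range
          nz_v va vb irrW).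
Qed.

(** * The finite set of candidates and the sum of their squared degrees *)

Definition unity_gen k := zeta ^+ (2 ^ k).

Lemma prim_unity_gen k : (k <= n)%N ->
  (2 ^ (n - k)).-primitive_root (unity_gen k).
Proof.
move=> le_kn; rewrite /unity_gen.
have -> : (2 ^ k = 2 ^ n %/ 2 ^ (n - k))%N by rewrite -expnB ?leq_subr ?subKn.
by rewrite dvdn_prim_root // dvdn_exp2l // leq_subr.
Qed.

(** Roots of unity are encoded by exponents of [unity_gen]. The tag k in the second summand stands
    for the orbit k + 2. *)
Definition irr_index : finType :=
  ('I_2 * 'I_(2 ^ (n - 2)) * 'I_2
   + {k : 'I_(n - 1) & 'I_(2 ^ (n - (k + 2)))})%type.

Definition orbit_index (k : 'I_(n - 1)) (t : 'I_(2 ^ (n - (k + 2)))) :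
  irr_index :=
  inr (Tagged (fun k : 'I_(n - 1) => 'I_(2 ^ (n - (k + 2)))) t).

Definition index_degree (j : irr_index) : nat :=
  if j is inr (existT k _) then (2 ^ k.+1)%N else 1%N.

(** This includes the existence of the candidate itself, which is known for every [j] only after the
    count. *)
Definition has_index (j : irr_index) d (W : mx_representation F G d) : Prop :=
  match j with
  | inl (i, t, e) =>
      exists2 V, rho_lin a b c (i, unity_gen 2 ^+ t, (-1) ^+ e) V & mx_rsim W V
  | inr (existT k t) =>
      exists2 V, rho_k a b c zeta n (k + 2) (unity_gen (k + 2) ^+ t) V
        & mx_rsim W V
  end.

Lemma has_index_degree j d (W : mx_representation F G d) :
  has_index j W -> d = index_degree j.
Proof.
case: j => [[[i t] e]|[k t]] [V _ /mxrank_rsim -> //].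
by rewrite /= addnK expnS mul2n addnn.
Qed.

Lemma has_index_rsim j d e (V : mx_representation F G d)
    (W : mx_representation F G e) :
  has_index j V -> has_index j W -> mx_rsim V W.
Proof.
case: j => [[[i t] e0]|[k t]] [V1 rhoV1 simV1] [W1 rhoW1 simW1].
  apply: mx_rsim_trans (mx_rsim_trans simV1 _) (mx_rsim_sym simW1).
  exact: eq_rho_lin rhoV1 rhoW1.
apply: mx_rsim_trans (mx_rsim_trans simV1 _) (mx_rsim_sym simW1).
exact: eq_rho_k rhoV1 rhoW1.
Qed.

Lemma has_index_sim j d e (V : mx_representation F G d)
    (W : mx_representation F G e) :
  mx_rsim V W -> has_index j W -> has_index j V.
Proof.
by move=> simVW; case: j => [[[i t] e0]|[k t]] [U rhoU simU];
  exists U => //; apply: mx_rsim_trans simVW simU.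
Qed.

Lemma repr1_index (W : mx_representation F G 1) : exists j, has_index (inl j) W.
Proof.
have [[[i omega] e] rhoW /= [omega1 e1]] := repr1_rho_lin W.
have [t Dt] := prim_rootP (prim_unity_gen (ltnW n_ge3)) omega1.
have [u Du] := sign_exponent e1.
by exists (i, t, u), W; rewrite -?Dt -?Du //; apply: mx_rsim_refl.
Qed.

Lemma irr_has_index d (W : mx_representation F G d) :
  mx_irreducible W -> exists j, has_index j W.
Proof.
case/irr_classification=> [d1 | [k [omega [k_range omega1 [V rhoV simWV]]]]].
  by subst d; have [j] := repr1_index W; exists (inl j).
have [k' lt_k' Dk] : exists2 k', (k' < n - 1)%N & k = (k' + 2)%N.
  by exists (k - 2)%N; lia.
rewrite {k}Dk in k_range omega1 V rhoV simWV *.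
have [|t Dt] := prim_rootP (@prim_unity_gen (k' + 2) _) omega1.
  by case/andP: k_range.
by exists (@orbit_index (Ordinal lt_k') t), V; rewrite -?Dt.
Qed.

Lemma sum_tagged_index (f : 'I_(n - 1) -> nat) (g : irr_index -> nat) :
    (forall k t, g (@orbit_index k t) = f k) -> (forall x, g (inl x) = 1%N) ->
  (\sum_j g j = 2 ^ n + \sum_(k < n - 1) 2 ^ (n - (k + 2)) * f k)%N.
Proof.
move=> gr gl; rewrite big_sumType /=; congr (_ + _)%N.
  under eq_bigr do rewrite gl.
  rewrite sum1_card !card_prod !card_ord mulnAC mulnC.
  by rewrite -[X in _ = (2 ^ X)%N](subnK (ltnW n_ge3)) expnD.
rewrite (eq_bigr (fun p => f (tag p))); last by case=> k t _; rewrite -(gr k t).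
rewrite -(sig_big_dep xpredT
            (fun (k : 'I_(n - 1)) (_ : 'I_(2 ^ (n - (k + 2)))) => true)
            (fun k _ => f k)) /=.
by apply: eq_bigr => k _; rewrite sum_nat_const card_ord.
Qed.

Lemma card_irr_index : #|irr_index| = (2 ^ n + 2 ^ (n - 1) - 1)%N.
Proof.
rewrite -sum1_card (sum_tagged_index (f := fun=> 1%N)) //.
rewrite -addnBA ?expn_gt0 //; congr (_ + _)%N.
(* Reversing the order of the orbits turns the counts 2^(n-(k+2)) into 2^k. *)
rewrite (reindex_inj rev_ord_inj) /=.
rewrite -sum_exp2.
apply: eq_bigr => k _; rewrite muln1; congr (2 ^ _)%N.
by have := ltn_ord k; lia.
Qed.

(** The tag k contributes 2^(n-(k+2)) 4^(k+1) = 2^(n+k), a geometric sum that adds 2^n (2^(n-1) - 1)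
    to the 2^n linear candidates. *)
Lemma sum_index_degree : (\sum_j index_degree j ^ 2 = #|G|)%N.
Proof.
rewrite (sum_tagged_index (f := fun k => (2 ^ k.+1) ^ 2)%N) // oG.
have -> : (2 ^ n * 2 ^ (n - 1) = 2 ^ n + 2 ^ n * (2 ^ (n - 1) - 1))%N.
  by rewrite mulnBr muln1 subnKC // leq_pmulr ?expn_gt0.
rewrite -sum_exp2 big_distrr /=; congr (_ + _)%N.
apply: eq_bigr => k _; rewrite -expnM -!expnD; congr (2 ^ _)%N.
by have := ltn_ord k; lia.
Qed.

(** Choosing an index for each irreducible class is injective, since an index determines the
    representation up to equivalence. It is onto because the squared degrees have the same total
    #|G| on both sides. *)
Lemma irr_index_bijective (sG : irrType F G) :
  exists2 f : sG -> irr_index, bijective f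
    & forall i, has_index (f i) (irr_repr i).
Proof.
have F'G : ([pchar F]^'.-group G)%g.
  by apply/pgroupP=> p _ _; rewrite inE /= Num.Theory.pchar_num.
have [f fP] := fin_all_exists (fun i : sG => irr_has_index (socle_irr i)).
exists f => //.
have f_inj : injective f.
  move=> i j Dfi; apply/eqP/socle_rsimP; apply: has_index_rsim (fP i) _.
  by rewrite Dfi; apply: fP.
have surj : forall j, exists i, f i = j.
  apply: (injective_weight_surj (wI := fun i => (irr_degree i ^ 2)%N)
           (wJ := fun j => (index_degree j ^ 2)%N)) => //.
  - by move=> i; rewrite -(has_index_degree (fP i)).
  - by case=> [[[]]|[]] *; rewrite !expn_gt0.
  by rewrite sum_index_degree sum_irr_degree_pchar //;
    apply: group_closure_closed_field.
apply: inj_card_bij => //; rewrite -(card_codom f_inj).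
apply/subset_leq_card/subsetP=> j _; have [i <-] := surj j.
exact: codom_f.
Qed.

Let sG : irrType F G := DecSocleType (regular_repr F G).

(** Surjectivity of the bijection shows that the candidate matrices do define a representation. *)
Lemma index_realized j :
  exists d (W : mx_representation F G d), mx_irreducible W /\ has_index j W.
Proof.
have [f [g _ fK] fP] := irr_index_bijective sG.
exists (irr_degree (g j)), (irr_repr (g j)); split; first exact: socle_irr.
by rewrite -{1}(fK j); apply: fP.
Qed.

Lemma has_index_irr j d (W : mx_representation F G d) :
  has_index j W -> mx_irreducible W.
Proof.
move=> Wj; have [e [V [irrV Vj]]] := index_realized j.
exact: mx_rsim_irr (has_index_rsim Vj Wj) irrV.
Qed.

Lemma has_index_inj j j' d (W : mx_representation F G d) :
  has_index j W -> has_index j' W -> j = j'.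
Proof.
have [f [g _ fK] fP] := irr_index_bijective sG.
have simW l : has_index l W -> mx_rsim (irr_repr (g l)) W.
  by apply: has_index_rsim; rewrite -{1}(fK l); apply: fP.
move=> /simW sim_j /simW sim_j'; rewrite -(fK j) -(fK j'); congr f.
exact/eqP/socle_rsimP/(mx_rsim_trans sim_j)/mx_rsim_sym.
Qed.

Lemma num_irr_classes :
  num_repr_classes (fun d (V : mx_representation F G d) => mx_irreducible V)
    (2 ^ n + 2 ^ (n - 1) - 1).
Proof.
have [f f_bij fP] := irr_index_bijective sG.
rewrite -card_irr_index -(bij_eq_card f_bij).
exists (fun i => irr_degree (enum_val i)), (fun i => irr_repr (enum_val i)).
split=> [i | i j simij | d W irrW]; first exact: socle_irr.
  by apply: enum_val_inj; apply/eqP/socle_rsimP.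
have [j Wj] := irr_has_index irrW; have [g _ fK] := f_bij.
exists (enum_rank (g j)); rewrite enum_rankK.
by apply: has_index_rsim Wj _; rewrite -{1}(fK j); apply: fP.
Qed.

Lemma rho_lin_exists i omega e :
    omega ^+ (2 ^ (n - 2)) = 1 -> e = 1 \/ e = -1 ->
  exists V : mx_representation F G 1, rho_lin a b c (i, omega, e) V.
Proof.
move=> omega1 e1; have [t Dt] := prim_rootP (prim_unity_gen (ltnW n_ge3))
  omega1.
have [u Du] := sign_exponent e1.
have [d [W [_ [V rhoV _]]]] := index_realized (inl (i, t, u)).
by exists V; rewrite Dt Du.
Qed.

Lemma signI2_inj : injective (fun i : 'I_2 => (-1 : F) ^+ i).
Proof.
case=> [[|[|//]] ?] [[|[|//]] ?] //= /eqP; try by move=> _; apply: val_inj.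
  by rewrite expr0 expr1 -subr_eq0 opprK -mulr2n Num.Theory.pnatr_eq0.
by rewrite expr0 expr1 eq_sym -subr_eq0 opprK -mulr2n Num.Theory.pnatr_eq0.
Qed.

Lemma rho_lin_inj x y (V W : mx_representation F G 1) :
  rho_lin a b c x V -> rho_lin a b c y W -> mx_rsim V W -> x = y.
Proof.
have scalar_inj (u v : F) : u%:M = v%:M :> 'M_1 -> u = v.
  by move/matrixP/(_ 0 0); rewrite !mxE.
case: x y => [[i omega] e] [[j omega'] e'] [Va Vb Vc] [Wa Wb Wc] /mx_rsim1_eq
  eqVW.
have := (eqVW a Ga, eqVW b Gb, eqVW c Gc); rewrite Va Vb Vc Wa Wb Wc.
by case=> [[/scalar_inj/signI2_inj-> /scalar_inj->] /scalar_inj->].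
Qed.

(* Recovers the parameters [(k, omega)] of [rho_k]; junk on linear indices. *)
Definition index_param (j : irr_index) : nat * F :=
  if j is inr (existT k t) then ((k + 2)%N, unity_gen (k + 2) ^+ t)
  else (0%N, 0).

Lemma rho_k_index k omega : (2 <= k <= n)%N -> omega ^+ (2 ^ (n - k)) = 1 ->
  exists2 j, index_param j = (k, omega)
    & forall V, rho_k a b c zeta n k omega V -> has_index j V.
Proof.
move=> k_range omega1.
have [k' lt_k' Dk] : exists2 k', (k' < n - 1)%N & k = (k' + 2)%N.
  by exists (k - 2)%N; lia.
rewrite {k}Dk in k_range omega1 *.
have [|t Dt] := prim_rootP (@prim_unity_gen (k' + 2) _) omega1.
  by case/andP: k_range.
exists (@orbit_index (Ordinal lt_k') t) => [|V rhoV]; first by rewrite /= -Dt.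
by exists V; rewrite -?Dt //; apply: mx_rsim_refl.
Qed.

Lemma rho_k_exists k omega : (2 <= k <= n)%N -> omega ^+ (2 ^ (n - k)) = 1 ->
  exists V : mx_representation F G _, rho_k a b c zeta n k omega V.
Proof.
move=> k_range omega1.
have [k' lt_k' Dk] : exists2 k', (k' < n - 1)%N & k = (k' + 2)%N.
  by exists (k - 2)%N; lia.
rewrite {k}Dk in k_range omega1 *.
have [|t Dt] := prim_rootP (@prim_unity_gen (k' + 2) _) omega1.
  by case/andP: k_range.
have [d [W [_ [V rhoV _]]]] := index_realized (@orbit_index (Ordinal lt_k') t).
by exists V; rewrite Dt.
Qed.

Lemma rho_k_irr k omega (V : mx_representation F G _) :
    (2 <= k <= n)%N -> omega ^+ (2 ^ (n - k)) = 1 ->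
  rho_k a b c zeta n k omega V -> mx_irreducible V.
Proof.
move=> k_range omega1; have [j _ Vj] := rho_k_index k_range omega1.
by move/Vj/has_index_irr.
Qed.

Lemma rho_k_inj k l omega nu (V W : mx_representation F G _) :
    (2 <= k <= n)%N -> omega ^+ (2 ^ (n - k)) = 1 ->
    (2 <= l <= n)%N -> nu ^+ (2 ^ (n - l)) = 1 ->
    rho_k a b c zeta n k omega V -> rho_k a b c zeta n l nu W -> mx_rsim V W ->
  (k, omega) = (l, nu).
Proof.
move=> k_range omega1 l_range nu1 rhoV rhoW simVW.
have [j <- /(_ _ rhoV) Vj] := rho_k_index k_range omega1.
have [j' <- /(_ _ rhoW) Wj] := rho_k_index l_range nu1.
by rewrite (has_index_inj Vj (has_index_sim simVW Wj)).
Qed.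

(** * Little groups *)

Local Notation K := <<[set b; c]>>%G.

Lemma conj_a_K y : y \in K ->
  exists j, exists2 e : bool, y = (b ^+ j * c ^+ e)%g
    & (a ^ y = if e then a ^- (5 ^ j) else a ^+ (5 ^ j))%g.
Proof.
case/(bc_subgroupP c_exp conj_bc)=> j [e ->]; exists j, e => //.
rewrite conjgM (conj_a_bX conj_ab); case: e => /=; last by rewrite conjg1.
by rewrite conjXg conj_ac expgVn.
Qed.

Lemma K_abelian : abelian K.
Proof.
rewrite /= abelian_gen; apply/centsP=> x + y; rewrite !inE.
have cbc : commute b c by apply/commgP/conjg_fixP.
by move=> /orP[] /eqP-> /orP[] /eqP-> //; apply: commute_sym.
Qed.

Lemma conj_bX_K i y : y \in K -> (b ^+ i ^ y = b ^+ i)%g.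
Proof.
move=> Ky; apply/conjg_fixP/commgP/(centsP K_abelian) => //.
by rewrite groupX // mem_gen // !inE eqxx.
Qed.

Lemma sub_KG : K \subset G.
Proof.
by rewrite gen_subG; apply/subsetP=> x; rewrite !inE => /orP[] /eqP->.
Qed.

(** Conjugation by y sends the eigenvalue z to its power 5^j or -5^j; the second is never z, and the
    first is z only if 2^(k-2) divides j. This determines both the little groups and the kernel of
    the faithful representation. *)
Lemma fixed_eigenvalue_K k (H : {group gT}) m d (W : mx_representation F H d)
    (v : 'M_(m, d)) z y :
    (2 ^ (k - 2 + 2)).-primitive_root z -> a \in H -> v != 0 -> y \in K ->
    v *m W a = z *: v -> v *m W (a ^ y)%g = z *: v ->
  y \in <[b ^+ (2 ^ (k - 2))]>%g.
Proof.
move=> prim_z Ha nz_v Ky va; have [j [[] -> ->]] := conj_a_K Ky.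
  have nz_z : z ^+ (5 ^ j) != 0.
    by rewrite expf_neq0 // (prim_root_eq0 prim_z) expn_eq0.
  rewrite (repr_eigenV _ nz_z (repr_eigenX _ Ha va)) ?groupX //.
  move/(scalemx_eqI nz_v)/esym/eqP; rewrite -{1}[z]expr1.
  by rewrite (negPf (prim_root_exp5_neqV 0 j prim_z)).
rewrite (repr_eigenX _ Ha va) => /(scalemx_eqI nz_v)/eqP.
rewrite (prim_root_exp5 _ prim_z) => /dvdnP[q ->].
by rewrite mulg1 mulnC expgM mem_cycle.
Qed.

(** Powers of [a] centralize <[a]>, so the conjugating element can be taken in [K]. It is kept as y
    in order to move eigenvectors between the eigenvalue mu of [chi] and the base eigenvalue of the
    orbit. *)
Lemma orbit_chiP k (chi : mx_representation F <[a]>%G 1) : (2 <= k <= n)%N ->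
    orbit_chi G zeta (2 ^ (n - k)) chi ->
  exists y mu, [/\ y \in K, chi a = mu%:M,
    chi (a ^ (y^-1))%g = (zeta ^+ (2 ^ (n - k)))%:M,
    (2 ^ (k - 2 + 2)).-primitive_root mu
  & forall d (W : mx_representation F G d) (v : 'rV_d),
      v *m W a = zeta ^+ (2 ^ (n - k)) *: v -> v *m W (a ^ y)%g = mu *: v].
Proof.
move=> k_range [chi0 chi0a [g Gg Echi]].
have prim_lam := prim_orbit_root hzeta k_range.
set lam := zeta ^+ _ in chi0a prim_lam *.
have nz_lam i : lam ^+ i != 0.
  by rewrite expf_neq0 // (prim_root_eq0 prim_lam) expn_eq0.
have [i [y Ky Dg]] := normal_form genG conj_ab conj_ac Gg.
have Gy := subsetP sub_KG y Ky.
have Na : a \in <[a]>%G by apply: cycle_id.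
have Echi' x : x \in <[a]>%G -> chi x = chi0 (x ^ y)%g.
  move=> Nx; rewrite Echi // Dg conjgM; congr (chi0 (_ ^ y)%g).
  apply/conjg_fixP/commgP; have /cycleP[l ->] := Nx.
  exact/commuteX2/commute_refl.
have chi0_lam: 1%:M *m chi0 a = lam *: 1%:M.
  by rewrite mul1mx scale_scalar_mx mulr1.
have chiV : chi (a ^ (y^-1))%g = lam%:M.
  rewrite Echi' ?conjgKV // memJ_norm //.
  by apply: (subsetP (a_norm genG conj_ab conj_ac)); rewrite groupV.
have [j [e _ ay]] := conj_a_K Ky.
have prim_5 : (2 ^ (k - 2 + 2)).-primitive_root (lam ^+ (5 ^ j)).
  by rewrite prim_root_exp_coprime // coprimeXl // coprimeXr.
exists y, (if e then lam ^- (5 ^ j) else lam ^+ (5 ^ j)); split=> //.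
- rewrite Echi' // ay -[LHS]mul1mx; case: (e).
    rewrite (repr_eigenV _ _ (repr_eigenX _ Na chi0_lam)) ?groupX //.
    by rewrite scale_scalar_mx mulr1.
  by rewrite (repr_eigenX _ Na chi0_lam) scale_scalar_mx mulr1.
- by case: (e); first exact: prim_rootV.
move=> d W v va; rewrite ay; case: (e); last exact: repr_eigenX.
by apply: repr_eigenV; rewrite ?groupX //; apply: repr_eigenX.
Qed.

Section LittleGroup.

Variables (k : nat) (chi : mx_representation F <[a]>%G 1) (mu : F).
Hypotheses (k_range : (2 <= k <= n)%N) (chi_a : chi a = mu%:M).
Hypothesis prim_mu : (2 ^ (k - 2 + 2)).-primitive_root mu.

Let s := (2 ^ (k - 2))%N.
Let I := stabilizer_group G chi.
Let Na : a \in <[a]>%G. Proof. exact: cycle_id. Qed.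

Let chi_mu : 1%:M *m chi a = mu *: 1%:M.
Proof. by rewrite mul1mx chi_a scale_scalar_mx mulr1. Qed.

Lemma mem_stabilizer g : g \in G -> chi (a ^ g)%g = chi a -> g \in I.
Proof.
move=> Gg chi_ag; have Ng := subsetP (a_norm genG conj_ab conj_ac) g Gg.
apply/setIdP; split; first exact/setIP.
apply/forall_inP=> _ /cycleP[i ->]; rewrite conjXg.
by rewrite !(repr_mxX chi) ?memJ_norm // chi_ag.
Qed.

Lemma stabilizer_a : a \in I.
Proof. by apply: mem_stabilizer; rewrite // conjgE mulKg. Qed.

Lemma stabilizer_b : (b ^+ s)%g \in I.
Proof.
apply: mem_stabilizer; rewrite ?groupX // (conj_a_bX conj_ab).
rewrite -[LHS]mul1mx (repr_eigenX _ Na chi_mu) chi_a scale_scalar_mx mulr1.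
by congr _%:M; apply/eqP; rewrite (prim_root_exp5 _ prim_mu).
Qed.

Lemma stabilizer_K y : y \in I -> y \in K -> y \in <[b ^+ s]>%g.
Proof.
case/setIdP=> _ /forall_inP/(_ a Na)/eqP chi_ay Ky.
apply: (fixed_eigenvalue_K prim_mu Na (oner_neq0 _) Ky chi_mu).
by rewrite chi_ay chi_mu.
Qed.

(** As [I] contains [a] and b^s, the b^p c^e with p < s and e a bit meet every coset. *)
Lemma stabilizer_index : (#|rcosets I G| <= s + s)%N.
Proof.
pose f (p : 'I_s * bool) := (I :* (b ^+ p.1 * c ^+ p.2))%g.
suffices sIf : rcosets I G \subset f @: setT.
  apply: leq_trans (subset_leq_card sIf) _.
  apply: leq_trans (leq_imset_card _ _) _.
  by rewrite cardsT card_prod card_ord card_bool muln2 addnn.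
apply/subsetP=> _ /rcosetsP[g Gg ->].
have [i [_ /(bc_subgroupP c_exp conj_bc)[j [e ->]] ->]] :=
  normal_form genG conj_ab conj_ac Gg.
have lt_js : (j %% s < s)%N by rewrite ltn_mod expn_gt0.
apply/imsetP; exists (Ordinal lt_js, e); rewrite // /f /=.
have -> : (a ^+ i * (b ^+ j * c ^+ e) =
    a ^+ i * (b ^+ s) ^+ (j %/ s) * (b ^+ (j %% s) * c ^+ e))%g.
  by rewrite -expgM mulnC -!mulgA; congr (_ * _)%g;
    rewrite mulgA -expgD -divn_eq.
by rewrite rcosetM rcoset_id // groupM // groupX ?stabilizer_a ?stabilizer_b.
Qed.

(** The induced representation contains a line on which [I] acts by [U]. Translated by y, it has the
    eigenvalues that characterize [rho_k] with this [omega], and the index bounds the degree. *)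
Lemma ind_rho_k y (U : mx_representation F I 1) omega :
    y \in K -> chi (a ^ (y^-1))%g = (zeta ^+ (2 ^ (n - k)))%:M ->
    {in <[a]>%G, U =1 chi} -> U (b ^+ s)%g = omega%:M ->
  exists2 V, rho_k a b c zeta n k omega V
    & mx_rsim (ind_repr (stabilizer_sub G chi) U) V.
Proof.
move=> Ky chi_ay U_chi Ub; set W := ind_repr _ U.
have [E freeE EW] := ind_repr_embed U (stabilizer_sub G chi).
have Gy := subsetP sub_KG y Ky.
have Nay : (a ^ (y^-1))%g \in <[a]>%G.
  rewrite memJ_norm //.
  by apply: (subsetP (a_norm genG conj_ab conj_ac)); rewrite groupV.
have Iay : (a ^ (y^-1))%g \in I.
  by apply: subsetP Nay; rewrite cycle_subG stabilizer_a.
have Ea : E *m W (a ^ (y^-1))%g = zeta ^+ (2 ^ (n - k)) *: E.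
  by rewrite EW // U_chi // chi_ay mul_scalar_mx.
have Eb : E *m W ((b ^+ s) ^ (y^-1))%g = omega *: E.
  by rewrite conj_bX_K ?groupV // EW ?stabilizer_b // Ub mul_scalar_mx.
(* The double inverse is the shape given by [repr_eigenJ] for conjugation by y^-1. *)
have nz_v : E *m W (y^-1^-1)%g != 0.
  rewrite -mxrank_eq0 mxrankMfree ?repr_mx_free ?groupV //.
  by rewrite (eqP freeE).
apply: (eigenvector_rho_k genG c_exp conj_ab conj_ac conj_bc hzeta k_range
  nz_v).
- by apply: repr_eigenJ; rewrite ?groupV.
- by apply: repr_eigenJ; rewrite ?groupV ?groupX.
by rewrite sum_nat_const card_ord muln1 stabilizer_index.
Qed.

End LittleGroup.

Lemma little_group_rho_k k (chi : mx_representation F <[a]>%G 1) d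
    (W : mx_representation F G d) :
    (2 <= k <= n)%N -> orbit_chi G zeta (2 ^ (n - k)) chi ->
    little_group_repr chi K W ->
  exists omega V, [/\ omega ^+ (2 ^ (n - k)) = 1,
    rho_k a b c zeta n k omega V & mx_rsim W V].
Proof.
move=> k_range chiO [chi' [m [rho [rho' [[chi'N chi'H] irr_rho [rho'N rho'H]
  simW]]]]].
have [y [mu [Ky chi_a chi_ay prim_mu _]]] := orbit_chiP k_range chiO.
have cHH : abelian (stabilizer_group G chi :&: K).
  exact: abelianS (subsetIr _ _) K_abelian.
(* The little group is abelian, so [rho] is a linear character; [omega] will be its value at b^s. *)
have m1 := mx_irr_abelian_linear (@group_closure_closed_field F _ _)
  irr_rho cHH.
subst m.
set s := (2 ^ (k - 2))%N.
have Ia := stabilizer_a chi; have Ib := stabilizer_b chi_a prim_mu.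
have Hb : (b ^+ s)%g \in (stabilizer_group G chi :&: K)%G.
  by rewrite inE Ib groupX // mem_gen // !inE eqxx.
pose U : mx_representation F (stabilizer_group G chi) 1 := prod_repr chi' rho'.
have UE x : x \in stabilizer_group G chi -> U x = chi' x 0 0 *: rho' x.
  by move=> Ix; rewrite prod_repr_lin // castmx_id.
have U_chi : {in <[a]>%G, U =1 chi}.
  move=> x Nx; rewrite UE; last by apply: subsetP Nx; rewrite cycle_subG.
  by rewrite rho'N // chi'N // scale_scalar_mx mulr1 -mx11_scalar.
have Ub : U (b ^+ s)%g = (rho (b ^+ s)%g 0 0)%:M.
  by rewrite UE // chi'H // rho'H // !mxE eqxx scale1r -mx11_scalar.
have [V rhoV simV] := ind_rho_k k_range chi_a prim_mu Ky chi_ay U_chi Ub.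
exists (rho (b ^+ s)%g 0 0), V; split=> //; last exact: mx_rsim_trans simW simV.
apply: (eigenvalue_bX_unity (W := rho) (v := 1%:M) k_range Hb (oner_neq0 _)).
by rewrite mul1mx scale_scalar_mx mulr1 -mx11_scalar.
Qed.

(** Found without computing with the matrices: [irr_eigenvector] gives such a vector for some pair
    of parameters, and [rho_k_inj] identifies that pair with (k, omega). *)
Lemma rho_k_eigenvector k omega (V : mx_representation F G _) :
    (2 <= k <= n)%N -> omega ^+ (2 ^ (n - k)) = 1 ->
    rho_k a b c zeta n k omega V ->
  exists2 v : 'rV_(2 ^ (k - 2) + 2 ^ (k - 2)), v != 0
    & v *m V a = zeta ^+ (2 ^ (n - k)) *: v /\
    v *m V (b ^+ (2 ^ (k - 2)))%g = omega *: v.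
Proof.
move=> k_range omega1 rhoV; have irrV := rho_k_irr k_range omega1 rhoV.
(* The degree is even, which excludes degree 1. *)
have [/(congr1 odd) | [l [nu [v [l_range nz_v va vb]]]]] :=
  irr_eigenvector irrV.
  by rewrite oddD addbb.
have nu1 : nu ^+ (2 ^ (n - l)) = 1.
  by apply: eigenvalue_bX_unity l_range _ nz_v vb; rewrite groupX.
have [W rhoW simVW] := irr_eigenvector_rho_k genG c_exp conj_ab conj_ac conj_bc
  hzeta l_range nz_v va vb irrV.
have [Dk Domega] := rho_k_inj k_range omega1 l_range nu1 rhoV rhoW simVW.
by rewrite -Dk -Domega in va vb; exists v.
Qed.

Lemma orbit_chi_exists k : (2 <= k <= n)%N ->
  exists chi : mx_representation F <[a]>%G 1,
    orbit_chi G zeta (2 ^ (n - k)) chi.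
Proof.
move=> k_range; have [V rhoV] := rho_k_exists k_range (expr1n _ _).
have [v nz_v [va _]] := rho_k_eigenvector k_range (expr1n _ _) rhoV.
have sNG : <[a]>%G \subset G by rewrite cycle_subG.
have [x /cycleP[i ->]|chi chiE] := eigenvector_repr (W := V) sNG nz_v.
  by rewrite (repr_eigenX _ Ga va) scalemx_sub.
exists chi, chi; last by exists 1%g => // x _; rewrite conjg1.
have free_v : row_free v by rewrite -row_leq_rank lt0n mxrank_eq0.
apply: (row_free_inj free_v); rewrite -chiE ?cycle_id // va.
by rewrite mul_scalar_mx.
Qed.

(** Constructs the data of the method: [chi'] is read off a line in the [rho_k] with omega = 1, and
    the character of the little group is the restriction of a linear character of [G]. By
    [ind_rho_k] they induce to the [rho_k] with the given [omega]. *)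
Lemma rho_k_little_group k (chi : mx_representation F <[a]>%G 1) omega
    (V : mx_representation F G _) :
    (2 <= k <= n)%N -> orbit_chi G zeta (2 ^ (n - k)) chi ->
    omega ^+ (2 ^ (n - k)) = 1 -> rho_k a b c zeta n k omega V ->
  little_group_repr chi K V.
Proof.
move=> k_range chiO omega1 rhoV.
have [y [mu [Ky chi_a chi_ay prim_mu muE]]] := orbit_chiP k_range chiO.
have Gy := subsetP sub_KG y Ky.
pose I := stabilizer_group G chi; pose s := (2 ^ (k - 2))%N.
have sIG : I \subset G by apply: stabilizer_sub.
have Ia := stabilizer_a chi; have Ib := stabilizer_b chi_a prim_mu.
have [V1 rhoV1] := rho_k_exists k_range (expr1n _ _).
have [v1 nz_v1 [v1a v1b]] := rho_k_eigenvector k_range (expr1n _ _) rhoV1.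
(* On this vector [a] acts by mu and b^s trivially, so its line extends [chi] to [I] trivially on
   the little group. *)
pose v := v1 *m V1 (y^-1)%g.
have nz_v : v != 0.
  by rewrite -mxrank_eq0 mxrankMfree ?mxrank_eq0 ?repr_mx_free ?groupV.
have free_v : row_free v by rewrite -row_leq_rank lt0n mxrank_eq0.
have va : v *m V1 a = mu *: v by apply: repr_eigenJ => //; apply: muE.
have vb : v *m V1 (b ^+ s)%g = 1 *: v.
  by apply: repr_eigenJ; rewrite ?groupX ?conj_bX_K.
have vK x : x \in I -> x \in K -> v *m V1 x = v.
  move=> Ix Kx.
  have /cycleP[i ->] := stabilizer_K chi_a prim_mu Ix Kx.
  by rewrite (repr_eigenX _ _ vb) ?groupX // expr1n scale1r.
have vN i : v *m V1 (a ^+ i)%g = mu ^+ i *: v by apply: repr_eigenX.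
have I_form x : x \in I -> exists i, exists2 z, z \in I :&: K
  & x = (a ^+ i * z)%g.
  move=> Ix.
  have [i [z Kz Dx]] := normal_form genG conj_ab conj_ac (subsetP sIG x Ix).
  by exists i, z; rewrite // inE Kz andbT -(groupMl _ (groupX i Ia)) -Dx.
have [x Ix|chi' chi'E] := eigenvector_repr (W := V1) sIG nz_v.
  have [i [z /setIP[Iz Kz] ->]] := I_form x Ix.
  have Gz := subsetP sIG z Iz.
  by rewrite repr_mxM ?groupX // mulmxA vN -scalemxAl vK // scalemx_sub.
have sHG : (I :&: K)%G \subset G by apply: subset_trans (subsetIl _ _) sIG.
have [t Dt] := prim_rootP (prim_unity_gen (proj2 (andP k_range))) omega1.
(* A root of X^s = omega: nu = zeta^(4t) and omega = zeta^(2^k t), with 4 s = 2^k. *)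
pose nu := unity_gen 2 ^+ t.
have Dnu : nu ^+ s = omega.
  rewrite Dt /nu /unity_gen -!exprM mulnCA -expnD mulnC subnKC //.
  by case/andP: k_range.
have nu1 : nu ^+ (2 ^ (n - 2)) = 1.
  by rewrite /nu exprAC (prim_expr_order (prim_unity_gen (ltnW n_ge3))) expr1n.
have [L [La Lb Lc]] := rho_lin_exists 0 nu1 (or_introl erefl).
have L1 : 1%:M *m L a = 1 *: 1%:M by rewrite mul1mx La expr0 scale1r.
have irrL (H : {group gT}) (sH : H \subset G) : mx_irreducible (subg_repr L sH).
  exact/mx_abs_irrW/linear_mx_abs_irr.
have rho'N : {in <[a]>%G, forall x, subg_repr L sIG x = 1%:M}.
  move=> _ /cycleP[i ->] /=.
  by rewrite -[LHS]mul1mx (repr_eigenX _ Ga L1) expr1n scale1r.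
have chi'N : {in <[a]>%G, forall x, chi' x = chi x}.
  move=> _ /cycleP[i ->]; apply: (row_free_inj free_v).
  rewrite -chi'E ?groupX // vN (repr_mxX chi) ?cycle_id // chi_a -rmorphXn /=.
  by rewrite mul_scalar_mx.
have chi'H : {in (I :&: K)%G, forall x, chi' x = 1%:M}.
  move=> x /setIP[Ix Kx]; apply: (row_free_inj free_v).
  by rewrite -chi'E // vK // mul1mx.
exists chi', 1%N, (subg_repr L sHG), (subg_repr L sIG); split=> //.
pose U : mx_representation F I 1 := prod_repr chi' (subg_repr L sIG).
have UE x : x \in I -> U x = chi' x 0 0 *: L x.
  by move=> Ix; rewrite prod_repr_lin // castmx_id.
have U_chi : {in <[a]>%G, U =1 chi}.
  move=> x Nx; rewrite UE; last by apply: subsetP Nx; rewrite cycle_subG.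
  rewrite -[L x]/(subg_repr L sIG x) rho'N // chi'N //.
  by rewrite scale_scalar_mx mulr1 -mx11_scalar.
have Kb : (b ^+ s)%g \in K by rewrite groupX // mem_gen // !inE eqxx.
have Ub : U (b ^+ s)%g = omega%:M.
  have Hb : (b ^+ s)%g \in (I :&: K)%G by rewrite inE Ib.
  rewrite UE // chi'H // mxE eqxx scale1r -Dnu.
  by rewrite (repr_mxX L) // Lb -rmorphXn.
have [W rhoW simW] := ind_rho_k k_range chi_a prim_mu Ky chi_ay U_chi Ub.
apply: mx_rsim_trans (eq_rho_k genG rhoV rhoW) _; exact: mx_rsim_sym simW.
Qed.

(** * Parametrizations and counts: degree one, then each orbit *)

Lemma linear_parametrized :
  parametrized_by (fun d (_ : mx_representation F G d) => d = 1%N)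
    (fun x : 'I_2 * F * F =>
       x.1.2 ^+ (2 ^ (n - 2)) = 1 /\ (x.2 = 1 \/ x.2 = -1))
    (rho_lin a b c).
Proof.
split=> // [[[i omega] e] [omega1 e1] | x y V W _ _ | d W d1].
- exact: rho_lin_exists.
- exact: rho_lin_inj.
subst d; have [x rhoW x1] := repr1_rho_lin W.
by exists x, W; split=> //; apply: mx_rsim_refl.
Qed.

Lemma num_linear_classes :
  num_repr_classes (fun d (_ : mx_representation F G d) => d = 1%N) (2 ^ n).
Proof.
pose J : finType := ('I_2 * 'I_(2 ^ (n - 2)) * 'I_2)%type.
have -> : (2 ^ n)%N = #|J|.
  rewrite !card_prod !card_ord mulnAC mulnC.
  by rewrite -[X in (2 ^ X)%N = _](subnK (ltnW n_ge3)) expnD.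
have prim2 := prim_unity_gen (ltnW n_ge3).
pose e (j : J) : 'I_2 * F * F := (j.1.1, unity_gen 2 ^+ j.1.2, (-1) ^+ j.2).
apply: (num_repr_classes_parametrized (e := e) linear_parametrized).
- by move=> x V W; apply: eq_rho_lin.
- case=> [[i t] u] [[i' t'] u'] [-> /eqP + /signI2_inj ->].
  by rewrite (eq_prim_root_expr prim2) !modn_small // => /eqP/val_inj->.
- case=> [[i t] u]; split=> /=.
    by rewrite exprAC (prim_expr_order prim2) expr1n.
  by case: u => [[|[|//]] ?]; [left | right].
case=> [[i omega] x] /= [omega1 x1].
have [t Dt] := prim_rootP prim2 omega1.
have [u Du] := sign_exponent x1.
by exists (i, t, u); rewrite /e /= -Dt -Du.
Qed.

Section OrbitRepr.

Variables (k : nat) (chi : mx_representation F <[a]>%G 1).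
Hypotheses (k_range : (2 <= k <= n)%N).
Hypothesis chiO : orbit_chi G zeta (2 ^ (n - k)) chi.

Lemma orbit_parametrized :
  parametrized_by (little_group_repr chi K)
    (fun omega : F => omega ^+ (2 ^ (n - k)) = 1)
    (@rho_k F gT G a b c zeta n k).
Proof.
split=> [omega | omega V omega1 | omega nu V W omega1 nu1 rhoV rhoW simVW
  | d W lgW].
- exact: rho_k_exists.
- exact: rho_k_little_group.
- by have [] := rho_k_inj k_range omega1 k_range nu1 rhoV rhoW simVW.
by have [omega [V [omega1 rhoV simWV]]] := little_group_rho_k k_range chiO lgW;
  exists omega, V.
Qed.

Lemma num_orbit_classes :
  num_repr_classes (G := G) (little_group_repr chi K) (2 ^ (n - k)).
Proof.
have [_ le_kn] := andP k_range; have prim_k := prim_unity_gen le_kn.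
rewrite -[(2 ^ (n - k))%N]card_ord.
apply: (num_repr_classes_parametrized
          (e := fun t : 'I_(2 ^ (n - k)) => unity_gen k ^+ t)
            orbit_parametrized).
- by move=> x V W; apply: eq_rho_k.
- move=> t u /= /eqP; rewrite (eq_prim_root_expr prim_k) !modn_small //.
  by move/eqP/val_inj.
- by move=> t; rewrite exprAC (prim_expr_order prim_k) expr1n.
by move=> omega /(prim_rootP prim_k)[t ->]; exists t.
Qed.

Lemma orbit_irr d (V : mx_representation F G d) : little_group_repr chi K V ->
  mx_irreducible V /\ d = totient (2 ^ k).
Proof.
have [k_ge2 _] := andP k_range.
case/(little_group_rho_k k_range chiO)=> omega [W [omega1 rhoW simVW]]; split.
  exact: mx_rsim_irr (mx_rsim_sym simVW) (rho_k_irr k_range omega1 rhoW).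
rewrite (mxrank_rsim simVW) totient_pfactor // ?(ltnW k_ge2)
  // mul1n addnn -mul2n.
by rewrite -expnS -subSn // subSS subn1.
Qed.

End OrbitRepr.

(** * The faithful irreducible representation *)

Lemma n_range : (2 <= n <= n)%N. Proof. by rewrite leqnn andbT ltnW. Qed.

Lemma rho_n_eigenvector (V : mx_representation F G _) :
    rho_k a b c zeta n n 1 V ->
  exists2 v : 'rV_(2 ^ (n - 2) + 2 ^ (n - 2)), v != 0 & v *m V a = zeta *: v.
Proof.
move=> rhoV; have [v nz_v []] := rho_k_eigenvector n_range (expr1n _ _) rhoV.
by rewrite subnn expn0 expr1; exists v.
Qed.

Lemma order_a_dvd i : (a ^+ i = 1)%g -> (2 ^ n %| i)%N.
Proof.
move=> ai1; have [V rhoV] := rho_k_exists n_range (expr1n _ _).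
have [v nz_v va] := rho_n_eigenvector rhoV.
by rewrite (prim_order_dvd hzeta) (repr_eigen_unity nz_v Ga va ai1).
Qed.

(* An element acting trivially commutes with [a] on the [zeta]-eigenvector,   *)
(* hence lies in [<[a]>], which acts faithfully there.                        *)
Lemma rho_n_faithful (V : mx_representation F G _) :
  rho_k a b c zeta n n 1 V -> mx_faithful V.
Proof.
move=> rhoV; have [v nz_v va] := rho_n_eigenvector rhoV.
apply/subsetP=> x /rkerP[Gx Vx1]; rewrite inE.
have [i [y Ky Dx]] := normal_form genG conj_ab conj_ac Gx.
have vay : v *m V (a ^ y)%g = zeta *: v.
  have -> : (a ^ y = a ^ x)%g.
    rewrite Dx conjgM; congr (_ ^ y)%g; apply/esym/conjg_fixP/commgP.
    exact/commuteX/commute_refl.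
  by rewrite conjgE !repr_mxM ?groupM ?groupV // Vx1 mulmx1 repr_mxV // Vx1
    invmx1 mul1mx.
have prim_zeta : (2 ^ (n - 2 + 2)).-primitive_root zeta.
  by rewrite subnK // ltnW.
have := fixed_eigenvalue_K prim_zeta Ga nz_v Ky va vay.
rewrite b_exp cycle1 inE => /eqP y1; rewrite y1 mulg1 in Dx.
have := repr_eigenX i Ga va; rewrite -Dx Vx1 mulmx1 -{1}[v]scale1r.
move/(scalemx_eqI nz_v)/esym/eqP; rewrite -(prim_order_dvd hzeta).
by case/dvdnP=> q Di; rewrite Dx Di mulnC expgM a_exp expg1n.
Qed.

(** Since [a] has order 2^n, faithfulness excludes degree 1, which kills a^2, and the [rho_k] with k
    < n, which kill a^(2^k). For k = n the parameter is a first root of unity, hence 1. *)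
Lemma irr_faithful_rho_n d (W : mx_representation F G d) :
    mx_irreducible W -> mx_faithful W ->
  exists2 V, rho_k a b c zeta n n 1 V & mx_rsim W V.
Proof.
move=> irrW faithW; have a_inj i : (a ^+ i)%g \in rker W -> (2 ^ n %| i)%N.
  by move=> /(subsetP faithW); rewrite inE => /eqP/order_a_dvd.
have [d1 | [k [omega [k_range omega1 [V rhoV simWV]]]]] :=
  irr_classification irrW.
  subst d; have := a_inj 2 (repr1_a2_rker W).
  by rewrite -[X in (_ %| X)%N](expn1 2) dvdn_Pexp2l // leqNgt (ltnW n_ge3).
have [k_ge2 le_kn] := andP k_range.
have: (2 ^ n %| 2 ^ k)%N.
  apply: a_inj; rewrite (rker_mx_rsim simWV); apply/rkerP; rewrite groupX //.
  split=> //; apply/row_matrixP=> i; rewrite -{1}[V _]mul1mx row_mul.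
  have [Va _ _] := rhoV.
  have va : row i 1%:M *m V a
      = exp5_orbit (zeta ^+ (2 ^ (n - k))) i *: row i 1%:M.
    by rewrite -row_mul mul1mx -{1}[V a]mulmx1 Va row_rho_a_mul.
  rewrite (repr_eigenX _ Ga va) -[RHS]scale1r; congr (_ *: _).
  have prim_lam := prim_orbit_root hzeta k_range; rewrite subnK // in prim_lam.
  by rewrite /exp5_orbit; case: split => j; rewrite ?exprVn exprAC
    (prim_expr_order prim_lam) expr1n ?invr1.
rewrite dvdn_Pexp2l // => le_nk.
have Dk : k = n by apply/eqP; rewrite eqn_leq le_kn.
subst k; exists V => //; move: omega1; rewrite subnn expr1 => omega1.
by rewrite -omega1.
Qed.

End Classification.

(** * The order of the holomorph, and the final assembly *)

Lemma card_Hol (gT : finGroupType) (C : {group gT}) :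
  #|Hol C| = (#|C| * #|Aut C|)%N.
Proof.
have := sdprod_card (sdprod_sdpair [Aut C]%gact).
by rewrite !card_injm ?injm_sdpair1 ?injm_sdpair2 // => ->.
Qed.

Lemma card_Hol_Zp n : (0 < n)%N ->
  #|Hol (Zp_group (2 ^ n))| = (2 ^ n * 2 ^ (n - 1))%N.
Proof.
move=> n_gt0; have cycZ : cyclic (Zp_group (2 ^ n)).
  apply/cyclicP; rewrite /= /Zp; case: ifP => _.
    by exists Zp1; exact: Zp_cycle.
  by exists 1%g; rewrite cycle1.
rewrite card_Hol card_Aut_cyclic // card_Zp ?expn_gt0 //.
by rewrite totient_pfactor // mul1n subn1.
Qed.

Theorem theorem9p1p1 (R : realType) (n : nat) (hn : (3 <= n)%N)
    (gT : finGroupType) (G : {group gT})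
    (hG : G \isog Hol (Zp_group (2 ^ n)))
    (a b c : gT)
    (genG : G :=: <<[set a; b; c]>>%g)
    (a_exp : (a ^+ (2 ^ n) = 1)%g)
    (b_exp : (b ^+ (2 ^ (n - 2)) = 1)%g)
    (c_exp : (c ^+ 2 = 1)%g)
    (conj_ab : (b^-1 * a * b = a ^+ 5)%g)
    (conj_ac : (c^-1 * a * c = a^-1)%g)
    (conj_bc : (c^-1 * b * c = b)%g)
    (zeta : R[i]) (hzeta : (2 ^ n).-primitive_root zeta) :
  [/\ (* 1 *)
      [/\ num_repr_classes (fun d (_ : mx_representation R[i] G d) => d = 1%N)
            (2 * totient (2 ^ n)),
          (2 * totient (2 ^ n) = 2 ^ n)%N
        & parametrized_by (fun d (_ : mx_representation R[i] G d) => d = 1%N)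
            (fun x : 'I_2 * R[i] * R[i] =>
               x.1.2 ^+ (2 ^ (n - 2)) = 1 /\ (x.2 = 1 \/ x.2 = -1))
            (rho_lin a b c)],
      (* 2 *)
      forall k : nat, (2 <= k <= n)%N ->
        (exists chi : mx_representation R[i] <[a]>%G 1,
           orbit_chi G zeta (2 ^ (n - k)) chi) /\
        forall chi : mx_representation R[i] <[a]>%G 1,
          orbit_chi G zeta (2 ^ (n - k)) chi ->
        let from_orbit := little_group_repr chi <<[set b; c]>>%G in
        [/\ num_repr_classes from_orbit (2 ^ (n - k)),
            forall d (V : mx_representation R[i] G d), from_orbit d V ->
              mx_irreducible V /\ d = totient (2 ^ k)
          & parametrized_by from_orbit
              (fun omega : R[i] => omega ^+ (2 ^ (n - k)) = 1)
              (rho_k a b c zeta n k)],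
      (* 3 *)
      num_repr_classes
        (fun d (V : mx_representation R[i] G d) => mx_irreducible V)
        (\sum_(i < n.+1) 2 ^ i - 2 ^ (n - 1))
    & (* 4 *)
      exists V : mx_representation R[i] G (totient (2 ^ n)),
        [/\ mx_irreducible V,
            forall chi : mx_representation R[i] <[a]>%G 1,
              orbit_chi G zeta (2 ^ (n - n)) chi ->
              little_group_repr chi <<[set b; c]>>%G V /\
              forall d (W : mx_representation R[i] G d),
                little_group_repr chi <<[set b; c]>>%G W -> mx_rsim W V,
            mx_faithful V
          & forall d (W : mx_representation R[i] G d),
              mx_irreducible W -> mx_faithful W -> mx_rsim W V]].
Proof.
have n_gt0 : (0 < n)%N by apply: ltn_trans hn.
have oG : #|G| = (2 ^ n * 2 ^ (n - 1))%N by rewrite (card_isog hG) card_Hol_Zp.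
have ab : (a ^ b = a ^+ 5)%g by rewrite -conj_ab conjgE mulgA.
have ac : (a ^ c = a^-1)%g by rewrite -conj_ac conjgE mulgA.
have bc : (b ^ c = b)%g by rewrite -{2}conj_bc conjgE mulgA.
have totE : totient (2 ^ n) = (2 ^ (n - 1))%N.
  by rewrite totient_pfactor // mul1n subn1.
have tot2 : (2 * totient (2 ^ n) = 2 ^ n)%N by rewrite totE -expnS subn1 prednK.
split.
- split=> //; last first.
    exact: (linear_parametrized hn genG a_exp b_exp c_exp ab ac bc oG hzeta).
  by rewrite tot2; apply: (num_linear_classes hn genG a_exp b_exp c_exp ab ac
    bc oG hzeta).
- move=> k k_range; split.
    exact: (orbit_chi_exists hn genG a_exp b_exp c_exp ab ac bc oG hzeta).
  move=> chi chiO; split.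
  + exact: (num_orbit_classes hn genG a_exp b_exp c_exp ab ac bc oG hzeta
      k_range chiO).
  + exact: (orbit_irr hn genG a_exp b_exp c_exp ab ac bc oG hzeta
      k_range chiO).
  exact: (orbit_parametrized hn genG a_exp b_exp c_exp ab ac bc oG hzeta
      k_range chiO).
- have -> : (\sum_(i < n.+1) 2 ^ i - 2 ^ (n - 1) = 2 ^ n + 2 ^ (n - 1) - 1)%N.
    rewrite sum_exp2 expnS -tot2 totE; move: (2 ^ (n - 1))%N => x.
    by clear; lia.
  exact: (num_irr_classes hn genG a_exp b_exp c_exp ab ac bc oG hzeta).
(* Rewrites the degree into the dimension in the type of [rho_k], so that the witness has the
   required type. *)
have degE : totient (2 ^ n) = (2 ^ (n - 2) + 2 ^ (n - 2))%N.
  by rewrite totE addnn -mul2n -expnS -subSn // ltnW.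
rewrite degE.
have n_in := n_range hn; have one1 := expr1n R[i] (2 ^ (n - n)).
have [V rhoV] := rho_k_exists hn genG a_exp b_exp c_exp ab ac bc oG hzeta
  n_in one1.
exists V; split.
- exact: (rho_k_irr hn genG a_exp b_exp c_exp ab ac bc oG hzeta n_in one1 rhoV).
- move=> chi chiO.
  have [_ orbV _ orbE] := orbit_parametrized hn genG a_exp b_exp c_exp ab ac bc
    oG hzeta n_in chiO.
  split=> [|d W /orbE[omega [V' [omega1 rhoV' simW]]]]; first exact: orbV rhoV.
  rewrite subnn expr1 in omega1; rewrite omega1 in rhoV'.
  exact: mx_rsim_trans simW (eq_rho_k genG rhoV' rhoV).
- exact: (rho_n_faithful hn genG a_exp b_exp c_exp ab ac bc oG hzeta rhoV).
move=> d W irrW faithW.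
have [V' rhoV' simW] := irr_faithful_rho_n hn genG a_exp b_exp c_exp ab ac bc
  oG hzeta irrW faithW.
exact: mx_rsim_trans simW (eq_rho_k genG rhoV' rhoV).
Qed.
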